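(* Let $L\ge1$ be an integer and let $\rho,\alpha,\beta,\delta,\zeta>0$. Let $\gamma_1,\dots,\gamma_L$ be independent and identically distributed nonnegative random variables with cumulative distribution function $F(\gamma)=\frac{1}{1+(\gamma/(\rho\alpha))^{-\beta}}$ for $\gamma>0$. Let $f_{\gamma_{SC}}$ be the probability density function of $\gamma_{SC}=\max\{\gamma_1,\dots,\gamma_L\}$. Then the average bit error rate $\overline{P_e}=\int_0^\infty\delta\,\mathrm{erfc}\left(\sqrt{\zeta\gamma}\right)f_{\gamma_{SC}}(\gamma)\,d\gamma$ satisfies $$\overline{P_e}=\frac{\delta}{\sqrt\pi\,\Gamma(L)}\,H_{4,3}^{2,3}\left[\frac{1}{\zeta\alpha\rho}\;\middle|\;\begin{matrix}(0,1/\beta),(1,1),(\tfrac12,1),(1,1)\\ (L,1/\beta),(1,1),(0,1)\end{matrix}\right],$$ where $H_{p,q}^{m,n}$ is the (univariate) Fox H-function.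
   Context: The complementary error function is $\mathrm{erfc}(x)=\frac{2}{\sqrt\pi}\int_x^\infty e^{-t^2}dt$. The univariate Fox H-function is $$H_{p,q}^{m,n}\left[z\;\middle|\;\begin{matrix}(a_1,A_1),\dots,(a_p,A_p)\\(b_1,B_1),\dots,(b_q,B_q)\end{matrix}\right]=\frac{1}{2\pi i}\int_{c}\frac{\prod_{j=1}^m\Gamma(b_j-B_jt)\prod_{j=1}^n\Gamma(1-a_j+A_jt)}{\prod_{j=n+1}^p\Gamma(a_j-A_jt)\prod_{j=m+1}^q\Gamma(1-b_j+B_jt)}\,z^{t}\,dt,$$ where the contour $c$ runs from $-i\infty$ to $+i\infty$ and separates the poles of the $\Gamma(b_j-B_jt)$, $1\le j\le m$, (on its right) from the poles of the $\Gamma(1-a_j+A_jt)$, $1\le j\le n$ (on its left). For the parameters in the claim one may take a vertical line $\mathrm{Re}\,t=\tau$ with $0<\tau<\min(1,\beta L)$. In the application, $\gamma_l$ is the SNR of the $l$-th branch of a selection combining receiver, $\rho$ is the average transmit SNR, and $\delta,\zeta$ are modulation-dependent parameters. *)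

(* Defs.v *)
From HB Require Import structures.
From mathcomp Require Import all_boot all_order all_algebra.
From mathcomp Require Import complex.
From mathcomp Require Import all_classical all_reals all_analysis.

Set Implicit Arguments.
Unset Strict Implicit.
Unset Printing Implicit Defensive.

Import Order.TTheory GRing.Theory Num.Theory.
Import numFieldNormedType.Exports.

Local Open Scope classical_set_scope.
Local Open Scope ring_scope.
Local Open Scope complex_scope.

Definition cintegrable (R : realType) (D : set R) (f : R -> R[i]) : Prop :=
  (@lebesgue_measure R).-integrable D (fun x => (complex.Re (f x))%:E) /\
  (@lebesgue_measure R).-integrable D (fun x => (complex.Im (f x))%:E).

(* Meaningful only when cintegrable D f. *)
Definition cintegral (R : realType) (D : set R) (f : R -> R[i]) : R[i] :=
  (\int[@lebesgue_measure R]_(x in D) complex.Re (f x))%R +i*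
  (\int[@lebesgue_measure R]_(x in D) complex.Im (f x))%R.

(* x ^ s = exp (s * ln x), for real x > 0 and complex s. *)
Definition cpow (R : realType) (x : R) (s : R[i]) : R[i] :=
  (x `^ complex.Re s)%:C *
  (cos (complex.Im s * ln x) +i* sin (complex.Im s * ln x)).

(* Euler's integral; it converges when 0 < Re z. *)
Definition euler_gamma (R : realType) (z : R[i]) : R[i] :=
  cintegral `]0, +oo[ (fun x : R => cpow x (z - 1) * (expR (- x))%:C).

(* The least N such that 0 < Re z + N. *)
Definition gamma_shift (R : realType) (z : R[i]) : nat :=
  if 0 < complex.Re z then 0%N else (Num.truncn (- complex.Re z)).+1.

(* The meromorphic continuation of Euler's integral, by means of
   Gamma (z + N) = z * (z + 1) * ... * (z + N - 1) * Gamma z.  At the poles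
   0, -1, -2, ... the product vanishes and, by the convention 0^-1 = 0, both
   cgamma z and (cgamma z)^-1 are 0; the latter is the right value for the
   entire function 1 / Gamma. *)
Definition cgamma (R : realType) (z : R[i]) : R[i] :=
  euler_gamma (z + (gamma_shift z)%:R) /
  \prod_(k < gamma_shift z) (z + (k : nat)%:R).

Definition erfc (R : realType) (x : R) : R :=
  2 / Num.sqrt pi * (\int[@lebesgue_measure R]_(t in `[x, +oo[) expR (- t ^+ 2))%R.

(* Fox H-function H_{p,q}^{m,n}.  The parameters (a_j, A_j) and (b_j, B_j) are
   the lists a and b, so that p = size a and q = size b. *)
Definition foxH_kernel (R : realType) (m n : nat) (a b : seq (R[i] * R))
    (t : R[i]) : R[i] :=
  ((\prod_(u <- take m b) cgamma (u.1 - u.2%:C * t)) *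
   (\prod_(u <- take n a) cgamma (1 - u.1 + u.2%:C * t))) /
  ((\prod_(u <- drop n a) cgamma (u.1 - u.2%:C * t)) *
   (\prod_(u <- drop m b) cgamma (1 - u.1 + u.2%:C * t))).

(* The vertical line Re t = tau has the poles of Gamma (b_j - B_j t), j <= m,
   on its right and those of Gamma (1 - a_j + A_j t), j <= n, on its left; the
   poles of Gamma are the nonpositive integers. *)
Definition foxH_separates (R : realType) (m n : nat) (a b : seq (R[i] * R))
    (tau : R) : Prop :=
  (forall u, u \in take m b -> forall (k : nat) (t : R[i]),
     u.1 - u.2%:C * t = - k%:R -> tau < complex.Re t) /\
  (forall u, u \in take n a -> forall (k : nat) (t : R[i]),
     1 - u.1 + u.2%:C * t = - k%:R -> complex.Re t < tau).

(* The Mellin-Barnes integrand at the point t = tau + i y of the line. *)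
Definition foxH_integrand (R : realType) (m n : nat) (a b : seq (R[i] * R))
    (z tau y : R) : R[i] :=
  foxH_kernel m n a b (tau +i* y) * cpow z (tau +i* y).

(* H_{p,q}^{m,n}[z | a ; b] = v for real z > 0, with vertical contours: some
   vertical line separates the poles, and along every such line the
   Mellin-Barnes integral converges absolutely and has the value v.  Since
   dt = i dy on the line, (2 pi i)^-1 dt becomes (2 pi)^-1 dy. *)
Definition is_foxH (R : realType) (m n : nat) (a b : seq (R[i] * R)) (z : R)
    (v : R[i]) : Prop :=
  (exists tau : R, foxH_separates m n a b tau) /\
  forall tau : R, foxH_separates m n a b tau ->
    cintegrable setT (foxH_integrand m n a b z tau) /\
    v = ((2 * pi)^-1)%:C * cintegral setT (foxH_integrand m n a b z tau).

Definition mutually_independent (d : measure_display) (T : measurableType d)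
    (R : realType) (P : probability T R) (L : nat)
    (X : 'I_L -> {RV P >-> R}) : Prop :=
  forall (J : {set 'I_L}) (A : 'I_L -> set R),
    (forall l, measurable (A l)) ->
    P (\bigcap_(l in [set` J]) (X l @^-1` A l)) =
    (\prod_(l in J) P (X l @^-1` A l))%E.

Definition identically_distributed (d : measure_display)
    (T : measurableType d) (R : realType) (P : probability T R) (L : nat)
    (X : 'I_L -> {RV P >-> R}) : Prop :=
  forall (l l' : 'I_L) (A : set R), measurable A ->
    distribution P (X l) A = distribution P (X l') A.

(* f is a probability density function of Y. *)
Definition is_pdf (d : measure_display) (T : measurableType d) (R : realType)
    (P : probability T R) (Y : T -> R) (f : R -> R) : Prop :=
  [/\ measurable_fun setT f,
      forall x, 0 <= f x
    & forall A : set R, measurable A ->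
        P (Y @^-1` A) = (\int[@lebesgue_measure R]_(x in A) (f x)%:E)%E].

(* The maximum of the X l; the initial value 0 is harmless for nonnegative X l
   and 0 < L. *)
Definition selection_combining (d : measure_display) (T : measurableType d)
    (R : realType) (P : probability T R) (L : nat)
    (X : 'I_L -> {RV P >-> R}) (w : T) : R :=
  \big[Num.max/0]_(l < L) X l w.

(* Average bit error rate for the SNR density f. *)
Definition average_ber (R : realType) (delta zeta : R) (f : R -> R) : R :=
  (\int[@lebesgue_measure R]_(g in `[0, +oo[)
     (delta * erfc (Num.sqrt (zeta * g)) * f g))%R.

(* Main.v *)
(* Put c = 1/beta and z = 1/(zeta alpha rho).  The maximum has distribution
   function F^L, so Tonelli and the substitution s = t^2 turn the error rate into
   (delta / sqrt pi) M with
     M = int_0^oo s^(-1/2) e^(-s) (1 + (s z)^(-beta))^(-L) ds.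
   On the other side, Gamma(1 - t) cancels in the kernel, which becomes
   c Gamma(ct) Gamma(L - ct) Gamma(1/2 + t) because Gamma(1 + t) = t Gamma(t).  By
   the Cahen-Mellin formula, the integral of Gamma(ct) x^(-ct) dy over the line
   t = tau + i y is (2 pi / c) e^(-x).  Taking x = u v and integrating against
   u^(L-1) e^(-u) du gives the integral of Gamma(ct) Gamma(L - ct) v^(-ct) as a
   multiple of Gamma(L) (1 + v)^(-L); taking v = (s z)^(-beta) and integrating
   against s^(-1/2) e^(-s) ds gives H = Gamma(L) M. *)
Require Import Defs.
From HB Require Import structures.
From mathcomp Require Import all_boot all_order all_algebra.
From mathcomp Require Import complex.
From mathcomp Require Import all_classical all_reals all_analysis.
From mathcomp Require Import measurable_realfun ring lra.

Set Implicit Arguments.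
Unset Strict Implicit.
Unset Printing Implicit Defensive.

Import Order.TTheory GRing.Theory Num.Theory.
Import numFieldNormedType.Exports.

Local Open Scope classical_set_scope.
Local Open Scope ring_scope.
Local Open Scope complex_scope.

(** * Improper integrals *)

(** Three obstacles shape the proof. Opening the Euler integral of the only Gamma factor in the
    Cahen-Mellin formula leaves a double integral with no decay in y, so that formula is reached
    through the damping e^(-e |y|) and a limit. Every later exchange of integrals needs decay in y;
    the bound C / (1 + y^2) for Gamma(ct) suffices, because Gamma(L - ct) and z^t are bounded on the
    line. Finally, cancelling Gamma(1 - t) and Gamma(t) in the kernel requires that Gamma have no
    zero with positive real part: a hypothetical zero is moved far to the right by the functional
    equation, where concentration of the Gamma law excludes it. Integrals over half-lines and over
    the line are reached from compact intervals, on which the fundamental theorem and the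
    substitution rule hold in their elementary form. *)

Section exhaustion.
Context {R : realType}.
Let mu := @lebesgue_measure R.
Variables (a b : R^nat) (A : set R).
Hypotheses (ab : forall n, a n < b n)
  (a_ninc : {homo a : m n / (m <= n)%N >-> n <= m})
  (b_ndec : {homo b : m n / (m <= n)%N >-> m <= n})
  (AE : A = \bigcup_n `[a n, b n]%classic).

Lemma exhaustion_sub n : `[a n, b n]%classic `<=` A.
Proof. by rewrite AE => x xn; exists n. Qed.

Lemma exhaustion_ndec :
  {homo (fun n => `[a n, b n]%classic) : m n / (m <= n)%N >-> (m <= n)%O}.
Proof.
move=> m n mn; apply/subsetPset => x /=; rewrite !in_itv/= => /andP[ax xb].
by rewrite (le_trans (a_ninc mn) ax) (le_trans xb (b_ndec mn)).
Qed.

Lemma measurable_exhaustion : measurable A.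
Proof. by rewrite AE; apply: bigcup_measurable. Qed.

Lemma ge0_cvg_exhaustion (f : R -> R) :
  measurable_fun A f -> (forall x, A x -> 0 <= f x) ->
  (\int[mu]_(x in `[a n, b n]) (f x)%:E)%E @[n --> \oo] -->
  (\int[mu]_(x in A) (f x)%:E)%E.
Proof.
move=> mf f0; rewrite [in X in _ --> X]AE.
apply: ge0_nondecreasing_set_cvg_integral => //.
- exact: exhaustion_ndec.
- move=> i; apply/measurable_EFinP; apply: measurable_funS mf => //.
    exact: measurable_exhaustion.
  exact: exhaustion_sub.
- by move=> i x /exhaustion_sub /f0; rewrite lee_fin.
Qed.

(** Dominated convergence with bound |f|: each point of [A] lies in all intervals from some index
    on, so the truncations of [f] are eventually constant there. *)
Lemma integrable_cvg_exhaustion (f : R -> R) :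
  mu.-integrable A (EFin \o f) ->
  (\int[mu]_(x in `[a n, b n]) f x)%R @[n --> \oo] -->
  (\int[mu]_(x in A) f x)%R.
Proof.
move=> fi; have mA := measurable_exhaustion.
have mf : measurable_fun A (EFin \o f) by case/integrableP: fi.
apply: fine_cvg; rewrite fineK; last exact: integrable_fin_num.
rewrite [X in X @ _ --> _](_ : _ = fun n =>
    (\int[mu]_(x in A) ((f \_ `[a n, b n]%classic) x)%:E)%E); last first.
  apply/funext => n.
  have {1}-> : `[a n, b n]%classic = A `&` `[a n, b n].
    by apply/esym/setIidPr/exhaustion_sub.
  rewrite integral_mkcondr; apply: eq_integral => x _.
  by rewrite !patchE; case: ifP.
apply: (@dominated_cvg _ _ _ mu _ mA _ _ (fun x => `|f x|%:E)).
- move=> n; apply/measurable_EFinP/measurable_restrict => //.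
  by move/measurable_EFinP : mf; apply: measurable_funS => // x [].
- move=> x; rewrite {1}AE => -[N _ xN].
  apply: cvg_near_cst; exists N => // n /= Nn.
  rewrite patchE; case: ifPn => // /negP; rewrite inE; case.
  exact: (subsetPset _ _ (exhaustion_ndec Nn)).
- by [].
- exact: integrable_norm fi.
- move=> n x Ax; rewrite abse_EFin lee_fin patchE; case: ifPn => // _.
  by rewrite normr0.
Qed.

(** Both sides are limits along the same exhaustion, so only the increments of [F] between its end
    points have to converge. *)
Lemma improper_FTC2 (f F : R -> R) (l : R) :
  (forall x, A x -> is_derive x 1 F (f x)) ->
  (forall x, A x -> {for x, continuous f}) ->
  mu.-integrable A (EFin \o f) ->
  F (b n) - F (a n) @[n --> \oo] --> l ->
  (\int[mu]_(x in A) f x)%R = l.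
Proof.
move=> dF cf fi Fl; have := integrable_cvg_exhaustion fi.
rewrite [X in X @ _](_ : _ = fun n => F (b n) - F (a n)).
  by move=> h; apply: (cvg_unique _ h Fl).
apply/funext => n; rewrite /Rintegral.
have subA x : x \in `[a n, b n] -> A x by exact: exhaustion_sub.
have cF x : x \in `[a n, b n] -> {for x, continuous F}.
  move=> /subA /dF [dFx _].
  exact/differentiable_continuous/derivable1_diffP.
rewrite (@continuous_FTC2 _ _ F).
- by [].
- exact: ab.
- apply: continuous_in_subspaceT => x; rewrite inE => xab.
  exact/cf/subA.
- split.
  + by move=> x xab; have [] := dF x (subA _ (subset_itv_oo_cc xab)).
  + by apply: cvg_at_right_filter; apply: cF; rewrite in_itv/= lexx ltW.
  + by apply: cvg_at_left_filter; apply: cF; rewrite in_itv/= lexx ltW.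
- move=> x xab; rewrite derive1E.
  by have [_ ->] := dF x (subA _ (subset_itv_oo_cc xab)).
Qed.

End exhaustion.

(** The images of the intervals exhaust [B], and monotone convergence applies on both sides. With
    nonnegative [G] and extended values the identity also covers the infinite case, so it can be
    used to prove integrability. *)
Lemma improper_substitution (R : realType) (a b : R^nat) (A B : set R)
    (phi dphi G : R -> R) :
  (forall n, a n < b n) ->
  {homo a : m n / (m <= n)%N >-> n <= m} ->
  {homo b : m n / (m <= n)%N >-> m <= n} ->
  A = \bigcup_n `[a n, b n]%classic ->
  B = \bigcup_n `[phi (a n), phi (b n)]%classic ->
  (forall x, A x -> is_derive x 1 phi (dphi x)) ->
  (forall x, A x -> {for x, continuous dphi}) ->
  (forall x, A x -> 0 <= dphi x) ->
  (forall x y, A x -> A y -> x < y -> phi x < phi y) ->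
  (forall y, B y -> {for y, continuous G}) ->
  (forall y, B y -> 0 <= G y) ->
  (\int[@lebesgue_measure R]_(y in B) (G y)%:E =
   \int[@lebesgue_measure R]_(x in A) (G (phi x) * dphi x)%:E)%E.
Proof.
move=> ab a_ninc b_ndec AE BE dphi_ cdphi dphi0 phi_inc cG G0.
have subA n x : x \in `[a n, b n] -> A x by exact: (exhaustion_sub AE).
have anA n : A (a n) by apply: (subA n); rewrite in_itv/= lexx ltW.
have bnA n : A (b n) by apply: (subA n); rewrite in_itv/= lexx ltW.
have phi_nd x y : A x -> A y -> x <= y -> phi x <= phi y.
  by move=> Ax Ay; rewrite le_eqVlt => /predU1P[->//|/(phi_inc _ _ Ax Ay)/ltW].
have phiAB x : A x -> B (phi x).
  move=> Ax; have := Ax; rewrite {1}AE BE => -[n _]; rewrite /= in_itv/=.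
  by move=> /andP[ax xb]; exists n => //=; rewrite in_itv/= !phi_nd.
have cphi x : A x -> {for x, continuous phi}.
  by move=> /dphi_ [dx _]; exact/differentiable_continuous/derivable1_diffP.
have cGphi x : A x -> {for x, continuous (fun x => G (phi x) * dphi x)}.
  move=> Ax; apply: cvgM; last exact: cdphi.
  by apply: (@continuous_comp _ _ _ phi G); [exact: cphi|exact/cG/phiAB].
have mA := measurable_exhaustion AE.
have mB := measurable_exhaustion BE.
have phi_n n : phi (a n) < phi (b n) by exact: phi_inc.
have phia : {homo (phi \o a) : m n / (m <= n)%N >-> n <= m}.
  by move=> m n /a_ninc; exact: phi_nd.
have phib : {homo (phi \o b) : m n / (m <= n)%N >-> m <= n}.
  by move=> m n /b_ndec; exact: phi_nd.
have mcont (D : set R) (f : R -> R) : measurable D ->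
    (forall x, D x -> {for x, continuous f}) -> measurable_fun D f.
  move=> mD cf; apply: subspace_continuous_measurable_fun => //.
  by apply: continuous_in_subspaceT => x; rewrite inE; exact: cf.
have cvgl := ge0_cvg_exhaustion phia phib BE (mcont _ _ mB cG) G0.
have cvgr := ge0_cvg_exhaustion a_ninc b_ndec AE (mcont _ _ mA cGphi)
  (fun x Ax => mulr_ge0 (G0 _ (phiAB _ Ax)) (dphi0 _ Ax)).
move: cvgl; rewrite [X in X @ _ --> _](_ : _ = fun n =>
    (\int[lebesgue_measure]_(x in `[a n, b n]) (G (phi x) * dphi x)%:E)%E).
  by move=> /(cvg_unique _) /(_ cvgr); apply.
apply/funext => n /=.
have phi'E x : A x -> phi^`()%classic x = dphi x.
  by move=> /dphi_ [_ <-]; rewrite derive1E.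
(* The derivative of [phi] is known to equal [dphi] only on [A]; its limits, one-sided at the end
   points, are transferred from the continuous [dphi] through the open interval. *)
have near_phi' (F : set_system R) (l : R) : Filter F ->
    (\forall y \near F, y \in `]a n, b n[) -> dphi y @[y --> F] --> l ->
    phi^`()%classic y @[y --> F] --> l.
  move=> FF Fab; apply: cvg_trans; apply: near_eq_cvg; near=> y.
  rewrite phi'E//; apply: (subA n); apply: subset_itv_oo_cc.
  by near: y; exact: Fab.
rewrite (@integration_by_substitution_increasing _ phi).
- by apply: eq_integral => x; rewrite inE => /subA Ax /=; rewrite fctE phi'E.
- exact/ltW.
- by move=> x y /subA Ax /subA Ay; exact: phi_inc.
- move=> x xab; rewrite /prop_for /continuous_at phi'E; last first.
    by apply: (subA n); exact: subset_itv_oo_cc.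
  apply: near_phi'; first exact: near_in_itvoo.
  by apply: cdphi; apply: (subA n); exact: subset_itv_oo_cc.
- apply/cvg_ex; exists (dphi (a n)); apply: near_phi'.
    by near=> y; rewrite in_itv/=; apply/andP; split.
  by apply: cvg_at_right_filter; exact: cdphi.
- apply/cvg_ex; exists (dphi (b n)); apply: near_phi'.
    by near=> y; rewrite in_itv/=; apply/andP; split.
  by apply: cvg_at_left_filter; exact: cdphi.
- split.
  + by move=> x /subset_itv_oo_cc /subA /dphi_ [].
  + by apply: cvg_at_right_filter; exact: cphi.
  + by apply: cvg_at_left_filter; exact: cphi.
- apply: continuous_in_subspaceT => y; rewrite inE => yab.
  by apply: cG; rewrite BE; exists n.
Unshelve. all: end_near. Qed.

Definition cmeasurable (R : realType) d (T : measurableType d) (D : set T)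
    (f : T -> R[i]) : Prop :=
  measurable_fun D (fun x => complex.Re (f x)) /\
  measurable_fun D (fun x => complex.Im (f x)).

(** * Complex-valued integrals *)

Section complex_parts.
Context {R : realType}.
Implicit Types z w : R[i].
Notation normc := ComplexField.Normc.normc.

Lemma cReM z w : complex.Re (z * w) =
  complex.Re z * complex.Re w - complex.Im z * complex.Im w.
Proof. by case: z w => [a b] [c d]. Qed.

Lemma cImM z w : complex.Im (z * w) =
  complex.Re z * complex.Im w + complex.Im z * complex.Re w.
Proof. by case: z w => [a b] [c d]. Qed.

Lemma cReD z w : complex.Re (z + w) = complex.Re z + complex.Re w.
Proof. by case: z w => [a b] [c d]. Qed.

Lemma cImD z w : complex.Im (z + w) = complex.Im z + complex.Im w.
Proof. by case: z w => [a b] [c d]. Qed.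

Lemma cReN z : complex.Re (- z) = - complex.Re z.
Proof. by case: z. Qed.

Lemma cImN z : complex.Im (- z) = - complex.Im z.
Proof. by case: z. Qed.

Lemma eq_ReIm z w :
  complex.Re z = complex.Re w -> complex.Im z = complex.Im w -> z = w.
Proof. by case: z w => [a b] [c d] /= -> ->. Qed.

Lemma Re_nat n : complex.Re (n%:R : R[i]) = n%:R.
Proof. by elim: n => // n ih; rewrite -[n.+1]addn1 !natrD cReD ih. Qed.

Lemma Im_nat n : complex.Im (n%:R : R[i]) = 0.
Proof. by elim: n => // n ih; rewrite -[n.+1]addn1 !natrD cImD ih addr0. Qed.

Lemma nat_complex n : (n%:R : R)%:C = n%:R.
Proof. by apply: eq_ReIm; rewrite ?Re_nat ?Im_nat. Qed.

Lemma Re_le_normc z : `|complex.Re z| <= normc z.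
Proof.
case: z => [a b] /=; rewrite -sqrtr_sqr ler_sqrt ?lerDl ?sqr_ge0//.
by rewrite addr_ge0 ?sqr_ge0.
Qed.

Lemma Im_le_normc z : `|complex.Im z| <= normc z.
Proof.
case: z => [a b] /=; rewrite -sqrtr_sqr ler_sqrt ?lerDr ?sqr_ge0//.
by rewrite addr_ge0 ?sqr_ge0.
Qed.

Lemma normc_le_ReIm z : normc z <= `|complex.Re z| + `|complex.Im z|.
Proof.
case: z => [a b] /=; rewrite -[leRHS]ger0_norm ?addr_ge0// -sqrtr_sqr.
rewrite ler_sqrt ?sqr_ge0// sqrrD !real_normK ?num_real// addrAC lerDl.
by rewrite mulrn_wge0// mulr_ge0.
Qed.

Lemma normc_ge0 z : 0 <= normc z.
Proof. exact: le_trans (Re_le_normc z). Qed.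

Lemma normc_real (r : R) : normc r%:C = `|r|.
Proof. by rewrite /= expr0n /= addr0 sqrtr_sqr. Qed.

Lemma cpow_realE (x r : R) : cpow x r%:C = (x `^ r)%:C.
Proof. by rewrite /cpow /= mul0r cos0 sin0 mulr1. Qed.

Lemma cpowD (x : R) z w : 0 < x -> cpow x (z + w) = cpow x z * cpow x w.
Proof.
move=> x0; rewrite /cpow cReD cImD powRD ?(gt_eqF x0) ?implybT// mulrDl.
rewrite cosD sinD; apply: eq_ReIm; rewrite !(cReM, cImM) /=; ring.
Qed.

Lemma cpow_mul (x y : R) z : 0 < x -> 0 < y ->
  cpow (x * y) z = cpow x z * cpow y z.
Proof.
move=> x0 y0; rewrite /cpow powRM ?ltW// lnM// mulrDr.
rewrite cosD sinD; apply: eq_ReIm; rewrite !(cReM, cImM) /=; ring.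
Qed.

Lemma cpow_powR (x r : R) z : 0 < x -> cpow (x `^ r) z = cpow x (r%:C * z).
Proof.
move=> x0; rewrite /cpow ln_powR cReM cImM /= mul0r subr0 mul0r addr0 powRrM.
by congr (_ * (cos _ +i* sin _)); ring.
Qed.


Lemma cpow_inv (x : R) z : 0 < x -> cpow x^-1 z = cpow x (- z).
Proof.
by move=> x0; rewrite -powR_inv1 ?ltW// cpow_powR// rmorphN1 mulN1r.
Qed.

Lemma cpowN1 (x : R) : 0 < x -> cpow x (- 1) = (x^-1)%:C.
Proof. by move=> x0; rewrite -powR_inv1 ?ltW// -cpow_realE rmorphN1. Qed.

Lemma normc_cpow (x : R) z : normc (cpow x z) = x `^ complex.Re z.
Proof.
rewrite ComplexField.Normc.normcM normc_real ger0_norm ?powR_ge0//=.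
by rewrite cos2Dsin2 sqrtr1 mulr1.
Qed.

End complex_parts.
Notation normc := ComplexField.Normc.normc.

Section complex_measurability.
Context {R : realType} d (T : measurableType d).
Variable D : set T.
Implicit Types f g : T -> R[i].

Lemma cmeasurableM f g : cmeasurable D f -> cmeasurable D g ->
  cmeasurable D (fun x => f x * g x).
Proof.
move=> [f1 f2] [g1 g2]; split.
  under eq_fun do rewrite cReM.
  by apply: measurable_funB; exact: measurable_funM.
under eq_fun do rewrite cImM.
by apply: measurable_funD; exact: measurable_funM.
Qed.

Lemma cmeasurable_real (f : T -> R) : measurable_fun D f ->
  cmeasurable D (fun x => (f x)%:C).
Proof. by move=> mf; split => //=; exact: measurable_cst. Qed.


(** The exponent runs along a vertical line: its constant real part makes the modulus a fixed real
    power of [f], and only the phase varies with [g]. *)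
Lemma cmeasurable_cpow (r : R) (f : T -> R) g : measurable_fun D f ->
  (forall x, complex.Re (g x) = r) ->
  measurable_fun D (fun x => complex.Im (g x)) ->
  cmeasurable D (fun x => cpow (f x) (g x)).
Proof.
move=> mf gr mg; rewrite /cpow; apply: cmeasurableM.
  apply: cmeasurable_real; under eq_fun do rewrite gr.
  exact: (measurableT_comp (measurable_powR r) mf).
have mgf : measurable_fun D (fun x => complex.Im (g x) * ln (f x)).
  by apply: measurable_funM => //; exact: (measurableT_comp (@measurable_ln R) mf).
split=> /=.
  exact: (measurableT_comp (continuous_measurable_fun (@continuous_cos R)) mgf).
exact: (measurableT_comp (continuous_measurable_fun (@continuous_sin R)) mgf).
Qed.

End complex_measurability.

Section lebesgue_integrable_real.
Context {R : realType}.
Let mu := @lebesgue_measure R.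
Implicit Types (D : set R) (f g : R -> R).

Lemma lebesgue_integrable_dominated D f g : measurable D -> measurable_fun D f ->
  (forall x, D x -> `|f x| <= g x) -> mu.-integrable D (EFin \o g) ->
  mu.-integrable D (EFin \o f).
Proof.
move=> mD mf fg; apply: le_integrable => //; first exact/measurable_EFinP.
move=> x Dx; rewrite !abse_EFin lee_fin (le_trans _ (ler_norm _))//.
exact: fg.
Qed.

Lemma lebesgue_integrableZ D (r : R) f : measurable D ->
  mu.-integrable D (EFin \o f) -> mu.-integrable D (EFin \o (fun x => r * f x)).
Proof. by move=> mD hf; apply: (integrableZl _ r hf). Qed.

Lemma lebesgue_integrableB D f g : measurable D ->
  mu.-integrable D (EFin \o f) -> mu.-integrable D (EFin \o g) ->
  mu.-integrable D (EFin \o (fun x => f x - g x)).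
Proof. by move=> mD hf hg; apply: (integrableB _ hf hg). Qed.

Lemma lebesgue_eq_integrable D f g : measurable D ->
  (forall x, D x -> f x = g x) ->
  mu.-integrable D (EFin \o f) -> mu.-integrable D (EFin \o g).
Proof. by move=> mD fg; apply: eq_integrable => // x; rewrite inE /= => /fg ->. Qed.

Lemma lebesgue_integrable_measurable D f : mu.-integrable D (EFin \o f) ->
  measurable_fun D f.
Proof. by case/integrableP => /measurable_EFinP. Qed.

Lemma EFin_Rintegral D f : measurable D -> mu.-integrable D (EFin \o f) ->
  ((\int[mu]_(x in D) f x)%R%:E = \int[mu]_(x in D) (f x)%:E)%E.
Proof. by move=> mD fi; rewrite /Rintegral fineK//; exact: integrable_fin_num. Qed.

End lebesgue_integrable_real.

Section complex_integral.
Context {R : realType}.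
Let mu := @lebesgue_measure R.
Implicit Types (D : set R) (f g : R -> R[i]).

Lemma cintegrable_measurable D f : cintegrable D f -> cmeasurable D f.
Proof. by case=> /integrableP[/measurable_EFinP ? _] /integrableP[/measurable_EFinP ? _]. Qed.

Lemma dominated_cintegrable D f (g : R -> R) : measurable D ->
  cmeasurable D f -> (forall x, D x -> normc (f x) <= g x) ->
  mu.-integrable D (EFin \o g) -> cintegrable D f.
Proof.
move=> mD [mf1 mf2] fg gi.
by split; apply: le_integrable gi => //; [exact/measurable_EFinP| |exact/measurable_EFinP|] => x Dx;
  rewrite !abse_EFin lee_fin (le_trans _ (ler_norm _))// (le_trans _ (fg _ Dx))//;
  rewrite (Re_le_normc, Im_le_normc).
Qed.

Lemma eq_cintegral D f g : (forall x, D x -> f x = g x) ->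
  cintegral D f = cintegral D g.
Proof.
move=> fg; rewrite /cintegral; congr (_ +i* _); apply: eq_Rintegral => x;
  by rewrite inE => /fg ->.
Qed.

Lemma eq_cintegrable D f g : measurable D -> (forall x, D x -> f x = g x) ->
  cintegrable D f -> cintegrable D g.
Proof.
move=> mD fg [f1 f2]; split; [apply: eq_integrable f1|apply: eq_integrable f2] => // x;
  by rewrite inE => /fg ->.
Qed.

Lemma cintegral_real D (f : R -> R) :
  cintegral D (fun x => (f x)%:C) = ((\int[mu]_(x in D) f x)%R)%:C.
Proof.
apply: eq_ReIm => //=.
by rewrite /Rintegral integral0_eq.
Qed.

Lemma cintegralZ D (z : R[i]) f : measurable D -> cintegrable D f ->
  cintegral D (fun x => z * f x) = z * cintegral D f.
Proof.
move=> mD [f1 f2].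
have zi (r : R) (h : R -> R) : mu.-integrable D (EFin \o h) ->
    mu.-integrable D (EFin \o (fun x => r * h x)).
  by move=> hi; apply: (integrableZl _ r hi).
apply: eq_ReIm; rewrite ?cReM ?cImM /=.
  under eq_Rintegral do rewrite cReM.
  by rewrite RintegralB//; [rewrite !RintegralZl|exact: zi|exact: zi].
under eq_Rintegral do rewrite cImM.
by rewrite RintegralD//; [rewrite !RintegralZl|exact: zi|exact: zi].
Qed.

Lemma cintegrableZ D (z : R[i]) f : measurable D -> cintegrable D f ->
  cintegrable D (fun x => z * f x).
Proof.
move=> mD fi; have [f1 f2] := fi.
have zi (r : R) (h : R -> R) : mu.-integrable D (EFin \o h) ->
    mu.-integrable D (fun x => (r * h x)%:E).
  by move=> hi; apply: (integrableZl _ r hi).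
split.
  under eq_fun do rewrite cReM EFinB.
  by apply: integrableB => //; exact: zi.
under eq_fun do rewrite cImM EFinD.
by apply: integrableD => //; exact: zi.
Qed.

Lemma cintegralB D f g : measurable D -> cintegrable D f -> cintegrable D g ->
  cintegral D (fun x => f x - g x) = cintegral D f - cintegral D g.
Proof.
move=> mD [f1 f2] [g1 g2]; apply: eq_ReIm; rewrite !(cReD, cImD, cReN, cImN) /=.
  by under eq_Rintegral do rewrite cReD cReN; rewrite RintegralB.
by under eq_Rintegral do rewrite cImD cImN; rewrite RintegralB.
Qed.

Lemma cintegrableB D f g : measurable D -> cintegrable D f -> cintegrable D g ->
  cintegrable D (fun x => f x - g x).
Proof.
move=> mD [f1 f2] [g1 g2]; split.
  by under eq_fun do rewrite cReD cReN EFinB; apply: integrableB.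
by under eq_fun do rewrite cImD cImN EFinB; apply: integrableB.
Qed.

(** The factor 2 comes from bounding the real and the imaginary part separately; the estimates built
    on this only ask for some finite constant. *)
Lemma normc_cintegral_le D f (g : R -> R) : measurable D -> cmeasurable D f ->
  (forall x, D x -> normc (f x) <= g x) -> mu.-integrable D (EFin \o g) ->
  normc (cintegral D f) <= 2 * (\int[mu]_(x in D) g x)%R.
Proof.
move=> mD mf fg gi; have [f1 f2] := dominated_cintegrable mD mf fg gi.
apply: le_trans (normc_le_ReIm _) _; rewrite /= mulr_natl mulr2n.
apply: lerD; (apply: le_trans; first exact: le_normr_Rintegral);
  (apply: le_Rintegral => //; first exact: integrable_norm);
  by move=> x /fg; apply: le_trans; rewrite (Re_le_normc, Im_le_normc).
Qed.

End complex_integral.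

(** * Exchange of integrals under a product bound *)

Section fubini_dominated.
Context {R : realType}.
Let mu := @lebesgue_measure R.
Variables (D1 D2 : set R) (p q : R -> R).
Hypotheses (mD1 : measurable D1) (mD2 : measurable D2).
Hypotheses (p_int : mu.-integrable D1 (EFin \o p))
  (q_int : mu.-integrable D2 (EFin \o q)).

(** A bound by a product of integrable functions makes the double integral absolutely convergent by
    Tonelli. The second conclusion is kept because it also yields measurability and integrability of
    functions defined by an integral, such as Gamma on a line. *)
Lemma fubini_dominated (f : R * R -> R) :
  measurable_fun (D1 `*` D2) f ->
  (forall x y, D1 x -> D2 y -> `|f (x, y)| <= p x * q y) ->
  (\int[mu]_(x in D1) \int[mu]_(y in D2) f (x, y) =
   \int[mu]_(y in D2) \int[mu]_(x in D1) f (x, y))%R /\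
  mu.-integrable D1 (fun x => (\int[mu]_(y in D2) f (x, y))%R%:E).
Proof.
move=> mf fpq.
have mD : measurable (D1 `*` D2) by exact: measurableX.
pose F (z : R * R) : \bar R := ((f \_ (D1 `*` D2)) z)%:E.
have mF : measurable_fun [set: R * R] F.
  by apply/measurable_EFinP; exact: (proj1 (measurable_restrictT f mD) mf).
(* Absolute values are taken because [p] and [q] need not be nonnegative one by one; extended by
   zero, [P] and [Q] dominate [F] on the whole plane. *)
pose P x : R := `|if x \in D1 then p x else 0|.
pose Q x : R := `|if x \in D2 then q x else 0|.
have Fabs x y : (`|F (x, y)| <= (P x)%:E * (Q y)%:E)%E.
  rewrite /F /P /Q /= lee_fin patchE in_setX /=.
  case: ifPn => [/andP[/[dup] Dx -> /[dup] Dy ->]|_]; last first.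
    by rewrite normr0 mulr_ge0.
  rewrite -normrM (le_trans _ (ler_norm _))//.
  by apply: fpq; rewrite -in_setE.
have restr_int D (h : R -> R) : measurable D ->
    mu.-integrable D (EFin \o h) ->
    mu.-integrable setT (EFin \o (fun x => `|if x \in D then h x else 0|)).
  move=> mD' /(integrable_mkcond _ mD'); rewrite restrict_EFin.
  exact: integrable_norm.
have pint := restr_int _ _ mD1 p_int.
have qint := restr_int _ _ mD2 q_int.
have P0 x : (0 <= (P x)%:E)%E by rewrite lee_fin /P.
have Q0 x : (0 <= (Q x)%:E)%E by rewrite lee_fin /Q.
have /integrableP[mP P_lt] := pint.
have /integrableP[mQ Q_lt] := qint.
have Fint : (mu \x mu)%E.-integrable setT F.
  apply/integrable12ltyP => //.
  have h x : (\int[mu]_y `|F (x, y)| <= (P x)%:E * \int[mu]_y (Q y)%:E)%E.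
    have <- : (\int[mu]_y ((P x)%:E * (Q y)%:E) = (P x)%:E * \int[mu]_y (Q y)%:E)%E.
      exact: ge0_integralZl.
    apply: ge0_le_integral => //.
    - by apply: measurableT_comp => //; exact: measurable_fun_pair2.
    - by apply/measurable_EFinP/measurable_funM; [exact: measurable_cst|exact/measurable_EFinP].
  apply: (@le_lt_trans _ _ (\int[mu]_x ((P x)%:E * \int[mu]_y (Q y)%:E))%E).
    apply: ge0_le_integral => //.
    - by move=> x _; exact: integral_ge0.
    - have mF' : measurable_fun setT (abse \o F) by exact: measurableT_comp.
      apply: (@measurable_fun_fubini_tonelli_F _ _ (measurableTypeR R) (measurableTypeR R) R mu (abse \o F)).
      exact: mF'.
      by move=> z; exact: abse_ge0.
    - by apply: emeasurable_funM => //; exact: measurable_cst.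
  have -> : (\int[mu]_x ((P x)%:E * \int[mu]_y (Q y)%:E) =
      \int[mu]_x (P x)%:E * \int[mu]_y (Q y)%:E)%E.
    by apply: ge0_integralZr => //; exact: integral_ge0.
  have fin (k : R -> R) : (forall x, 0 <= (k x)%:E)%E ->
      (\int[mu]_x `|(EFin \o k) x| < +oo)%E -> (\int[mu]_x (k x)%:E < +oo)%E.
    move=> k0; congr (_ < _)%E; apply: eq_integral => x _.
    by rewrite gee0_abs//=; exact: k0.
  apply: lte_mul_pinfty; first exact: integral_ge0.
    by rewrite ge0_fin_numE; [exact: fin P_lt|exact: integral_ge0].
  exact: fin Q_lt.
(* Integrable sections have finite inner integrals, so that passing to real values by [fine] loses
   nothing. *)
have sec1 x : D1 x -> mu.-integrable D2 (fun y => (f (x, y))%:E).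
  move=> Dx; apply: (@le_integrable _ _ _ mu _ mD2 _ (fun y => (p x * q y)%:E)); last first.
    - by apply: (integrableZl _ (p x) q_int).
    - move=> y Dy; rewrite !abse_EFin lee_fin (le_trans _ (ler_norm _))//.
      exact: fpq.
  apply: (@eq_measurable_fun _ _ _ _ _ (fun y => F (x, y))).
    by move=> y yD2; rewrite /F patchE in_setX yD2 andbT /= ifT// inE.
  by apply: measurable_funTS; exact: measurable_fun_pair2.
have sec2 y : D2 y -> mu.-integrable D1 (fun x => (f (x, y))%:E).
  move=> Dy; apply: (@le_integrable _ _ _ mu _ mD1 _ (fun x => (q y * p x)%:E)); last first.
    - by apply: (integrableZl _ (q y) p_int).
    - move=> x Dx; rewrite !abse_EFin lee_fin (le_trans _ (ler_norm _))//.
      by rewrite mulrC; exact: fpq.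
  apply: (@eq_measurable_fun _ _ _ _ _ (fun x => F (x, y))).
    by move=> x xD1; rewrite /F patchE in_setX xD1 /= ifT// inE.
  by apply: measurable_funTS; exact: measurable_fun_pair1.
have FE1 x : (\int[mu]_y F (x, y) =
    (((fun x => \int[mu]_(y in D2) f (x, y)) \_ D1) x)%R%:E)%E.
  rewrite patchE; case: ifPn => [|/negP] xD1.
    rewrite /Rintegral fineK.
      rewrite integral_mkcond; apply: eq_integral => y _.
      by rewrite /F !patchE in_setX xD1 /=; case: ifP.
    by apply: integrable_fin_num => //; apply: sec1; rewrite -in_setE.
  rewrite integral0_eq// => y _.
  by rewrite /F patchE in_setX; case: ifPn => // /andP[].
have FE2 y : (\int[mu]_x F (x, y) =
    (((fun y => \int[mu]_(x in D1) f (x, y)) \_ D2) y)%R%:E)%E.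
  rewrite patchE; case: ifPn => [|/negP] yD2.
    rewrite /Rintegral fineK.
      rewrite integral_mkcond; apply: eq_integral => x _.
      by rewrite /F !patchE in_setX yD2 andbT /=; case: ifP.
    by apply: integrable_fin_num => //; apply: sec2; rewrite -in_setE.
  rewrite integral0_eq// => x _.
  by rewrite /F patchE in_setX; case: ifPn => // /andP[].
split.
  rewrite Rintegral_mkcond [RHS]Rintegral_mkcond /Rintegral.
  have E1 := eq_integral (mu := mu) (D := setT) _ _ (fun x _ => FE1 x).
  have E2 := eq_integral (mu := mu) (D := setT) _ _ (fun y _ => FE2 y).
  by congr fine; rewrite -E1 -E2; exact: Fubini Fint.
have : mu.-integrable setT (fun x => \int[mu]_y F (x, y))%E.
  exact: integrable_fubini_F Fint.
move=> Fi; apply/integrable_mkcond => //; rewrite restrict_EFin.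
by apply: eq_integrable Fi => // x _; exact: FE1.
Qed.

Lemma cfubini (F : R -> R -> R[i]) :
  cmeasurable (D1 `*` D2) (fun z => F z.1 z.2) ->
  (forall x y, D1 x -> D2 y -> normc (F x y) <= p x * q y) ->
  cintegral D1 (fun x => cintegral D2 (F x)) =
  cintegral D2 (fun y => cintegral D1 (F ^~ y)) /\
  cintegrable D1 (fun x => cintegral D2 (F x)).
Proof.
move=> [mF1 mF2] Fpq.
have Re_bound x y : D1 x -> D2 y -> `|complex.Re (F x y)| <= p x * q y.
  by move=> Dx Dy; apply: le_trans (Re_le_normc _) _; exact: Fpq.
have Im_bound x y : D1 x -> D2 y -> `|complex.Im (F x y)| <= p x * q y.
  by move=> Dx Dy; apply: le_trans (Im_le_normc _) _; exact: Fpq.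
have [E1 I1] := fubini_dominated mF1 Re_bound.
have [E2 I2] := fubini_dominated mF2 Im_bound.
by split; [rewrite /cintegral /= E1 E2|split].
Qed.

End fubini_dominated.

(** * Derivatives and primitives *)

Section exhaustions.
Context {R : realType}.

(** The offset [n.+2] keeps the two end points distinct already at n = 0, where [n.+1] would give 1
    twice. *)
Lemma pos_exhaustion :
  `]0, +oo[%classic = \bigcup_n `[(n.+2%:R : R)^-1, n.+2%:R]%classic.
Proof.
apply/seteqP; split=> [x|x [n _]] /=; rewrite !in_itv/= ?andbT; last first.
  by move=> /andP[+ _]; apply: lt_le_trans; rewrite invr_gt0.
move=> x0; exists (maxn (Num.truncn x) (Num.truncn x^-1)) => //=.
have h (y : R) m : (Num.truncn y <= m)%N -> y <= m.+2%:R.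
  move=> ym; apply: (le_trans (ltW (truncnS_gt y))); rewrite ler_nat.
  exact: leqW.
rewrite in_itv/= h ?leq_maxl// andbT -[leRHS]invrK lef_pV2 ?posrE ?invr_gt0//.
by rewrite h ?leq_maxr.
Qed.

Lemma real_exhaustion :
  [set: R] = \bigcup_n `[- (n.+1%:R : R), n.+1%:R]%classic.
Proof.
apply/seteqP; split=> [x _|//]; exists (Num.truncn `|x|) => //=.
by rewrite in_itv/= -ler_norml ltW// truncnS_gt.
Qed.

Lemma neg_exhaustion : `]-oo, 0[%classic =
  \bigcup_n `[- (n.+2%:R : R), - (n.+2%:R)^-1]%classic.
Proof.
apply/seteqP; split=> [x|x [n _]] /=; rewrite !in_itv/=; last first.
  by move=> /andP[_]; move=> /le_lt_trans; apply; rewrite oppr_lt0 invr_gt0.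
rewrite -oppr_gt0 => x0.
have : `]0, +oo[%classic (- x) by rewrite /= in_itv/= x0.
rewrite pos_exhaustion => -[n _]; rewrite /= in_itv/= => /andP[h1 h2].
by exists n => //=; rewrite in_itv/= lerNl h2 lerNr h1.
Qed.

Lemma pos_lt n : (n.+2%:R : R)^-1 < n.+2%:R.
Proof. by rewrite (@lt_trans _ _ 1) ?invf_lt1 ?ltr1n. Qed.

Lemma pos_ninc : {homo (fun n => (n.+2%:R : R)^-1) : m n / (m <= n)%N >-> n <= m}.
Proof. by move=> m n mn; rewrite lef_pV2 ?posrE// ler_nat. Qed.

Lemma pos_ndec : {homo (fun n => n.+2%:R : R) : m n / (m <= n)%N >-> m <= n}.
Proof. by move=> m n mn; rewrite ler_nat. Qed.

Lemma real_lt n : - (n.+1%:R : R) < n.+1%:R.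
Proof. by rewrite (@lt_trans _ _ 0) ?oppr_lt0. Qed.

Lemma real_ninc : {homo (fun n => - (n.+1%:R : R)) : m n / (m <= n)%N >-> n <= m}.
Proof. by move=> m n mn; rewrite lerN2 ler_nat. Qed.

Lemma real_ndec : {homo (fun n => n.+1%:R : R) : m n / (m <= n)%N >-> m <= n}.
Proof. by move=> m n mn; rewrite ler_nat. Qed.

End exhaustions.

Lemma continuous_itvoy_measurable (R : realType) (D : set R) (f : R -> R) :
  measurable D -> (forall x, D x -> {for x, continuous f}) -> measurable_fun D f.
Proof.
move=> mD cf; apply: subspace_continuous_measurable_fun => //.
by apply: continuous_in_subspaceT => x; rewrite inE; exact: cf.
Qed.

(** Substitution with the constant integrand 1 turns the integral of [dphi] into the Lebesgue
    measure of the image of [phi], which lies in the bounded interval from l to r. *)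
Lemma integrable_bounded_primitive (R : realType) (a b : R^nat) (A : set R)
    (phi dphi : R -> R) (l r : R) :
  (forall n, a n < b n) ->
  {homo a : m n / (m <= n)%N >-> n <= m} ->
  {homo b : m n / (m <= n)%N >-> m <= n} ->
  A = \bigcup_n `[a n, b n]%classic ->
  (forall x, A x -> is_derive x 1 phi (dphi x)) ->
  (forall x, A x -> {for x, continuous dphi}) ->
  (forall x, A x -> 0 <= dphi x) ->
  (forall x y, A x -> A y -> x < y -> phi x < phi y) ->
  (forall x, A x -> l <= phi x <= r) ->
  (@lebesgue_measure R).-integrable A (EFin \o dphi).
Proof.
move=> ab an bn AE d1 d2 d3 d4 d5.
have mA := measurable_exhaustion AE.
apply/integrableP; split.
  by apply/measurable_EFinP; apply: continuous_itvoy_measurable.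
pose B := \bigcup_n `[phi (a n), phi (b n)]%classic.
have mB : measurable B by apply: bigcup_measurable.
have c1 y : B y -> {for y, continuous (cst (1 : R))}.
  by move=> _; exact: cst_continuous.
have h := @improper_substitution R a b A B phi dphi (cst 1) ab an bn AE erefl
  d1 d2 d3 d4 c1 (fun y _ => ler01).
have hB : (\int[lebesgue_measure]_(x in A) `|(EFin \o dphi) x| = lebesgue_measure B)%E.
  transitivity (\int[lebesgue_measure]_(y in B) (cst 1 y)%:E)%E; last first.
    by rewrite -[RHS]mul1e -integral_cst.
  rewrite h; apply: eq_integral => x; rewrite inE => Ax.
  by rewrite mul1r /= ger0_norm// d3.
rewrite hB; apply: (@le_lt_trans _ _ (lebesgue_measure `[l, r]%classic)).
  apply: le_measure; rewrite ?inE//.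
  move=> y [n _]; rewrite /= !in_itv/= => /andP[h1 h2].
  have Aa : A (a n) by rewrite AE; exists n => //=; rewrite in_itv/= lexx ltW.
  have Ab : A (b n) by rewrite AE; exists n => //=; rewrite in_itv/= lexx ltW.
  have /andP[la _] := d5 _ Aa; have /andP[_ rb] := d5 _ Ab.
  by rewrite (le_trans la h1) (le_trans h2 rb).
by rewrite lebesgue_measure_itv/=; case: ifP => //; rewrite ltry.
Qed.

(** Take ln (u / b) <= u / b, multiply by b and exponentiate. *)
Lemma powR_le_expR (R : realType) (b u : R) : 0 < b -> 0 < u ->
  u `^ b <= b `^ b * expR u.
Proof.
move=> b0 u0; rewrite /powR !gt_eqF// -expRD ler_expR.
have := ln_sublinear (divr_gt0 u0 b0); rewrite ln_div ?posrE// => h.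
have : b * (ln u - ln b) <= b * (u / b) by rewrite ler_pM2l// ltW.
by rewrite mulrCA divff ?gt_eqF// mulr1; lra.
Qed.

Section real_derivatives.
Context {R : realType}.
Implicit Types (f g : R -> R) (x : R).

Lemma is_derive_continuous f x df : is_derive x 1 f df -> {for x, continuous f}.
Proof. by case=> dx _; exact/differentiable_continuous/derivable1_diffP. Qed.

Lemma is_derive_mul f g x df dg : is_derive x 1 f df -> is_derive x 1 g dg ->
  is_derive x 1 (fun y => f y * g y) (df * g x + f x * dg).
Proof.
move=> hf hg; apply: is_derive_eq (is_deriveM hf hg) _.
by rewrite /GRing.scale /=; ring.
Qed.

Lemma is_derive_add f g x df dg : is_derive x 1 f df -> is_derive x 1 g dg ->
  is_derive x 1 (fun y => f y + g y) (df + dg).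
Proof. by move=> hf hg; exact: is_deriveD. Qed.

Lemma is_derive_opp f x df : is_derive x 1 f df ->
  is_derive x 1 (fun y => - f y) (- df).
Proof. by move=> hf; exact: is_deriveN. Qed.

Lemma is_derive_compose f g x df dg : is_derive (g x) 1 f df ->
  is_derive x 1 g dg -> is_derive x 1 (fun y => f (g y)) (df * dg).
Proof. by move=> hf hg; exact: is_derive1_comp. Qed.

Lemma is_derive_mulr_cst (k : R) x : is_derive x 1 (fun y => k * y) k.
Proof.
apply: is_derive_eq (is_derive_mul (is_derive_cst k x 1) (is_derive_id x 1)) _.
by rewrite mul0r add0r mulr1.
Qed.

Lemma is_derive_expRM (k : R) x :
  is_derive x 1 (fun y => expR (k * y)) (k * expR (k * x)).
Proof.
apply: is_derive_eq (is_derive_compose _ (is_derive_mulr_cst k x)) _.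
exact: mulrC.
Qed.

Lemma abs_sin_le x : `|sin x| <= `|x|.
Proof.
wlog x0 : x / 0 <= x.
  move=> h; have [/h//|/ltW x0] := leP 0 x.
  by rewrite -normrN -sinN -[leRHS]normrN h// oppr_ge0.
have [|y _] := @MVT_segment R sin cos 0 x x0 (fun y _ => is_derive_sin y).
  by apply: continuous_subspaceT; exact: continuous_sin.
rewrite sin0 !subr0 => ->; rewrite normrM ler_piMl//; exact: cos_max.
Qed.

(** The half-angle formula cos x = 1 - 2 sin^2 (x / 2) reduces this to |sin| <= |x|. *)
Lemma cos_ge x : 1 - x ^+ 2 / 2 <= cos x.
Proof.
have -> : x = (x / 2) *+ 2 by rewrite -mulr_natr; field.
rewrite cos_mulr2n cos2sin2.
have : sin (x / 2) ^+ 2 <= (x / 2) ^+ 2.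
  rewrite -[leLHS]real_normK ?num_real// -[leRHS]real_normK ?num_real//.
  by rewrite ler_sqr ?nnegrE ?abs_sin_le.
move: (sin _ ^+ 2) => t; rewrite (mulr2n (x / 2)) (mulr2n (1 - t)).
by rewrite (_ : (x / 2 + x / 2) ^+ 2 / 2 = 2 * (x / 2) ^+ 2); [lra|field].
Qed.

(** With q = ln x / 2 this reads q^2 <= (e^q - e^(-q))^2. The bound involves only x and 1/x, so
    integrating it against a Gamma density merely shifts the parameter by one in each direction. *)
Lemma sqr_ln_le x : 0 < x -> ln x ^+ 2 <= 4 * (x + x^-1 - 2).
Proof.
have key (q : R) : 0 <= q -> q ^+ 2 <= (expR q - expR (- q)) ^+ 2.
  move=> q0; rewrite ler_sqr ?nnegrE//.
    rewrite lerBrDl (le_trans _ (expR_ge1Dx _))// lerD2r.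
    by rewrite -expR0 ler_expR oppr_le0.
  by rewrite subr_ge0 ler_expR ge0_cp.
have key2 (q : R) : q ^+ 2 <= (expR q - expR (- q)) ^+ 2.
  have [/key//|/ltW q0] := leP 0 q.
  have := key (- q); rewrite oppr_ge0 sqrrN opprK => /(_ q0).
  by rewrite -[X in _ <= X]sqrrN opprB.
move=> x0; have := key2 (ln x / 2).
have e1 : expR (ln x / 2) ^+ 2 = x.
  by rewrite -expRM_natl mulrCA divff ?mulr1 ?lnK ?posrE.
have e2 : expR (- (ln x / 2)) ^+ 2 = x^-1.
  by rewrite expRN exprVn e1.
have e3 : expR (ln x / 2) * expR (- (ln x / 2)) = 1.
  by rewrite -expRD subrr expR0.
by rewrite sqrrB e1 e2 e3 exprMn; lra.
Qed.

End real_derivatives.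

Definition cderive (R : realType) (F : R -> R[i]) (x : R) (f : R[i]) : Prop :=
  is_derive x 1 (fun y => complex.Re (F y)) (complex.Re f) /\
  is_derive x 1 (fun y => complex.Im (F y)) (complex.Im f).

Section complex_derivatives.
Context {R : realType}.
Implicit Types (F G : R -> R[i]) (x : R).

Lemma cderiveM F G x f g : cderive F x f -> cderive G x g ->
  cderive (fun y => F y * G y) x (f * G x + F x * g).
Proof.
move=> [F1 F2] [G1 G2]; split.
  under eq_fun do rewrite cReM.
  apply: is_derive_eq (is_derive_add (is_derive_mul F1 G1)
    (is_derive_opp (is_derive_mul F2 G2))) _.
  by rewrite cReD !cReM; ring.
under eq_fun do rewrite cImM.
apply: is_derive_eq (is_derive_add (is_derive_mul F1 G2) (is_derive_mul F2 G1)) _.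
by rewrite cImD !cImM; ring.
Qed.

Lemma cderiveB F G x f g : cderive F x f -> cderive G x g ->
  cderive (fun y => F y - G y) x (f - g).
Proof.
move=> [F1 F2] [G1 G2]; split.
  under eq_fun do rewrite cReD cReN.
  by rewrite cReD cReN; exact: (is_derive_add F1 (is_derive_opp G1)).
under eq_fun do rewrite cImD cImN.
by rewrite cImD cImN; exact: (is_derive_add F2 (is_derive_opp G2)).
Qed.

Lemma cderive_cst z x : cderive (fun=> z) x 0.
Proof. by split; exact: is_derive_cst. Qed.

Lemma cderive_real (f : R -> R) x df : is_derive x 1 f df ->
  cderive (fun y => (f y)%:C) x df%:C.
Proof. by move=> h; split => //=; exact: is_derive_cst. Qed.

(** The last factor is i e^(i f) written in components. *)
Lemma cderive_cis (f : R -> R) x df : is_derive x 1 f df ->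
  cderive (fun y => cos (f y) +i* sin (f y)) x
    (df%:C * ((- sin (f x)) +i* cos (f x))).
Proof.
move=> h; split; rewrite (cReM, cImM) /=.
  by apply: is_derive_eq (is_derive_compose (is_derive_cos _) h) _; ring.
by apply: is_derive_eq (is_derive_compose (is_derive_sin _) h) _; ring.
Qed.

Lemma cderive_eq F x f g : cderive F x f -> f = g -> cderive F x g.
Proof. by move=> h <-. Qed.

Lemma cderive_cpow z x : 0 < x ->
  cderive (fun y => cpow y z) x (z * cpow x (z - 1)).
Proof.
move=> x0; case: z => r y.
have px : x `^ (r - 1) = x `^ r / x.
  by rewrite powRB ?(gt_eqF x0) ?implybT// powRr1// ltW.
have dl := is_derive1_ln x0; have dp := is_derive1_powR r x0.
apply: cderive_eq (cderiveM (cderive_real dp)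
  (cderive_cis (is_derive_mul (is_derive_cst y x 1) dl))) _.
rewrite /cpow /cst /=; apply: eq_ReIm;
  rewrite !(cReM, cImM, cReD, cImD) /= !(subr0, oppr0, addr0) px; ring.
Qed.

(** Differentiability of [f] serves here as a form of continuity that the product rules supply. *)
Lemma improper_cFTC2 (a b : R^nat) (A : set R) F (f : R -> R[i]) (l : R[i]) :
  (forall n, a n < b n) ->
  {homo a : m n / (m <= n)%N >-> n <= m} ->
  {homo b : m n / (m <= n)%N >-> m <= n} ->
  A = \bigcup_n `[a n, b n]%classic ->
  (forall x, A x -> cderive F x (f x)) ->
  (forall x, A x -> exists df, cderive f x df) ->
  cintegrable A f ->
  complex.Re (F (b n)) - complex.Re (F (a n)) @[n --> \oo] --> complex.Re l ->
  complex.Im (F (b n)) - complex.Im (F (a n)) @[n --> \oo] --> complex.Im l ->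
  cintegral A f = l.
Proof.
move=> ab an bn AE dF df [f1 f2] l1 l2; apply: eq_ReIm => /=.
  apply: (@improper_FTC2 _ a b A ab an bn AE (fun x => complex.Re (f x))
    (fun x => complex.Re (F x)) _ _ _ f1 l1).
    by move=> x /dF [].
  by move=> x /df [? [/is_derive_continuous]].
apply: (@improper_FTC2 _ a b A ab an bn AE (fun x => complex.Im (f x))
  (fun x => complex.Im (F x)) _ _ _ f2 l2).
  by move=> x /dF [].
by move=> x /df [? [_ /is_derive_continuous]].
Qed.

End complex_derivatives.

(** * Euler's gamma function *)

Section gamma_function.
Context {R : realType}.
Let mu := @lebesgue_measure R.
Let pos : set R := `]0, +oo[%classic.
Implicit Types (a : R) (z : R[i]).

Let pos_gt0 (u : R) : pos u -> 0 < u.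
Proof. by rewrite /pos /= in_itv/= andbT. Qed.

Let mpos : measurable pos.
Proof. exact: measurable_itv. Qed.

Definition rgamma a : R := (\int[mu]_(u in pos) (u `^ (a - 1) * expR (- u)))%R.

(** The comparison function is the derivative of atan (u^a), which has a bounded primitive. It
    behaves like u^(a-1) at 0 and like u^(-a-1) at infinity, so one majorant serves both ends. *)
Lemma integrable_rgamma a : 0 < a ->
  mu.-integrable pos (EFin \o (fun u => u `^ (a - 1) * expR (- u))).
Proof.
move=> a0; pose dphi u := (1 + (u `^ a) ^+ 2)^-1 * (a * u `^ (a - 1)).
have den_gt0 u : 0 < 1 + (u `^ a) ^+ 2 :> R by rewrite ltr_pwDl ?sqr_ge0.
have cpw (b u : R) : 0 < u -> {for u, continuous (fun u => u `^ b)}.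
  by move=> /is_derive1_powR => /(_ b) /is_derive_continuous.
have cdphi u : pos u -> {for u, continuous dphi}.
  move=> /pos_gt0 u0; apply: cvgM.
    apply: (@continuous_comp _ _ _ (fun u => u `^ a) (fun w => (1 + w ^+ 2)^-1)).
      exact: cpw.
    exact: continuous_oneDsqrV.
  by apply: cvgM; [exact: cvg_cst|exact: cpw].
have dphi_int : mu.-integrable pos (EFin \o dphi).
  apply: (@integrable_bounded_primitive R _ _ _ (fun u => atan (u `^ a)) _
    (- (pi / 2)) (pi / 2) pos_lt pos_ninc pos_ndec pos_exhaustion) => //.
  - move=> u /pos_gt0 u0.
    exact: (is_derive_compose (is_derive1_atan _) (is_derive1_powR _ u0)).
  - move=> u /pos_gt0 u0; apply: mulr_ge0; first by rewrite invr_ge0 ltW.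
    by rewrite mulr_ge0 ?powR_ge0 ?ltW.
  - move=> x y /pos_gt0 x0 /pos_gt0 y0 xy.
    have : x `^ a < y `^ a by rewrite gt0_ltr_powR ?nnegrE ?ltW.
    rewrite -[in X in X -> _](atanK (x `^ a)) -[in X in X -> _](atanK (y `^ a)).
    by rewrite ltr_tan// in_itv/= atan_gtNpi2 atan_ltpi2.
  - by move=> u _; rewrite !ltW ?atan_gtNpi2 ?atan_ltpi2.
(* Chosen so that 1 + u^(2a) <= K e^u, by [powR_le_expR] with exponent 2a. *)
pose K := 1 + (2 * a) `^ (2 * a).
apply: (lebesgue_integrable_dominated mpos _ _
    (lebesgue_integrableZ (K / a) mpos dphi_int)).
  apply: continuous_itvoy_measurable => // u /pos_gt0 u0.
  apply: cvgM; first exact: cpw.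
  by apply: (@continuous_comp _ _ _ -%R expR); [exact: opp_continuous|exact: continuous_expR].
move=> u /pos_gt0 u0; rewrite ger0_norm ?mulr_ge0 ?expR_ge0 ?powR_ge0//.
have -> : K / a * dphi u = u `^ (a - 1) * (K / (1 + (u `^ a) ^+ 2)).
  by rewrite /dphi; field; rewrite !gt_eqF.
rewrite ler_wpM2l ?powR_ge0// ler_pdivlMr// expRN mulrC ler_pdivrMr ?expR_gt0//.
have -> : (u `^ a) ^+ 2 = u `^ (2 * a).
  by rewrite mulrC powRrM powR_mulrn ?powR_ge0.
have -> : K * expR u = expR u + (2 * a) `^ (2 * a) * expR u by rewrite /K; ring.
rewrite lerD//.
  by rewrite -expR0 ler_expR ltW.
by apply: powR_le_expR => //; rewrite mulr_gt0.
Qed.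

Lemma cmeasurable_gamma z :
  cmeasurable pos (fun u => cpow u (z - 1) * (expR (- u))%:C).
Proof.
apply: cmeasurableM.
  by apply: (@cmeasurable_cpow _ _ _ _ (complex.Re (z - 1))) => //; exact: measurable_cst.
by apply: cmeasurable_real; apply: measurableT_comp.
Qed.

Lemma normc_gamma_integrand z u :
  normc (cpow u (z - 1) * (expR (- u))%:C) = u `^ (complex.Re z - 1) * expR (- u).
Proof.
by rewrite ComplexField.Normc.normcM normc_cpow normc_real ger0_norm ?expR_ge0// cReD.
Qed.

Lemma cintegrable_gamma z : 0 < complex.Re z ->
  cintegrable pos (fun u => cpow u (z - 1) * (expR (- u))%:C).
Proof.
move=> z0; apply: (dominated_cintegrable mpos (cmeasurable_gamma z) _ (integrable_rgamma z0)).
by move=> u _; rewrite normc_gamma_integrand.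
Qed.

Lemma euler_gamma_real a : euler_gamma a%:C = (rgamma a)%:C.
Proof.
rewrite /rgamma -cintegral_real; apply: eq_cintegral => u _.
by rewrite -[1]/(1%:C) -rmorphB cpow_realE -rmorphM.
Qed.

Lemma normc_euler_gamma_le z : 0 < complex.Re z ->
  normc (euler_gamma z) <= 2 * rgamma (complex.Re z).
Proof.
move=> z0; apply: normc_cintegral_le => //; first exact: cmeasurable_gamma.
  by move=> u _; rewrite normc_gamma_integrand.
exact: integrable_rgamma.
Qed.

(** Integration by parts: the difference of the two integrands is the derivative of u^z e^(-u),
    which vanishes at both ends. *)
Lemma euler_gammaS z : 0 < complex.Re z -> euler_gamma (z + 1) = z * euler_gamma z.
Proof.
move=> z0; apply/eqP; rewrite eq_sym -subr_eq0; apply/eqP.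
have z10 : 0 < complex.Re (z + 1) by rewrite cReD addr_gt0.
rewrite /euler_gamma -cintegralZ//; last exact: cintegrable_gamma.
have I1 := cintegrableZ z mpos (cintegrable_gamma z0).
have I2 := cintegrable_gamma z10.
rewrite -cintegralB//.
pose F u : R[i] := cpow u z * (expR (- u))%:C.
have normF u : normc (F u) = u `^ complex.Re z * expR (- u).
  rewrite /F ComplexField.Normc.normcM normc_cpow normc_real ger0_norm//.
have normF0 : normc (F n.+2%:R) + normc (F n.+2%:R^-1) @[n --> \oo] --> (0 : R).
  have inv0 : (n.+2%:R : R)^-1 @[n --> \oo] --> 0^'+.
    move=> P [e /= e0 Pe]; have [N _ hN] := near_infty_natSinv_lt (PosNum e0).
    exists N => // n Nn; apply: Pe => /=; last by rewrite invr_gt0.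
    rewrite sub0r normrN gtr0_norm//; apply: lt_trans (hN _ Nn).
    by rewrite ltf_pV2 ?posrE// ltr_nat.
  have inv0' : (n.+2%:R : R)^-1 @[n --> \oo] --> 0.
    by apply: cvg_trans inv0 _; exact: cvg_within.
  (* One extra power in [powR_le_expR] gives u^(Re z) e^(-u) <= K / u, which vanishes at
     infinity. *)
  pose K := (complex.Re z + 1) `^ (complex.Re z + 1).
  apply: (@squeeze_cvgr _ _ _ _ (cst 0)
      (fun n => K * n.+2%:R^-1 + (n.+2%:R^-1) `^ complex.Re z)).
  - apply: nearW => n; rewrite /cst !normF addr_ge0 ?mulr_ge0 ?powR_ge0 ?expR_ge0//= lerD//.
      rewrite expRN ler_pdivrMr ?expR_gt0// mulrAC ler_pdivlMr//.
      have {2}-> : n.+2%:R = (n.+2%:R : R) `^ 1 by rewrite powRr1.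
      rewrite -powRD ?pnatr_eq0 ?implybT//.
      by apply: powR_le_expR => //; rewrite addr_gt0.
    by rewrite ler_piMr ?powR_ge0// -expR0 ler_expR oppr_le0 invr_ge0.
  - exact: cvg_cst.
  - rewrite -[X in _ --> X](addr0 (0 : R)); apply: cvgD.
      by rewrite -[X in _ --> X](mulr0 K); apply: cvgM => //; exact: cvg_cst.
    exact: (cvg_comp _ _ inv0 (powR_cvg0 z0)).
have dexpN (u : R) : is_derive u 1 (fun u => expR (- u)) (- expR (- u)).
  by apply: is_derive_eq (is_derive_compose _ (is_deriveNid u 1)) _; rewrite mulrN1.
have cvgF (p : R[i] -> R) : (forall w, `|p w| <= normc w) ->
    p (F n.+2%:R) - p (F n.+2%:R^-1) @[n --> \oo] --> (0 : R).
  move=> pn; apply/norm_cvg0P; apply: (squeeze_cvgr _ (cvg_cst 0) normF0).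
  apply: nearW => n; rewrite normr_ge0 /= (le_trans (ler_normB _ _))//.
  by rewrite lerD.
apply: (@improper_cFTC2 R _ _ _ F _ 0 pos_lt pos_ninc pos_ndec pos_exhaustion).
- move=> u /pos_gt0 u0; apply: cderive_eq (cderiveM (cderive_cpow z u0) (cderive_real (dexpN u))) _.
  by rewrite addrK rmorphN mulrN mulrA.
- move=> u /pos_gt0 u0; eexists; apply: cderiveB.
    apply: cderiveM; first exact: cderive_cst.
    exact: (cderiveM (cderive_cpow _ u0) (cderive_real (dexpN u))).
  exact: (cderiveM (cderive_cpow _ u0) (cderive_real (dexpN u))).
- exact: cintegrableB.
- exact: (cvgF _ (@Re_le_normc _)).
- exact: (cvgF _ (@Im_le_normc _)).
Unshelve. all: end_near. Qed.

Lemma rgammaS a : 0 < a -> rgamma (a + 1) = a * rgamma a.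
Proof.
move=> a0; have := @euler_gammaS a%:C a0.
rewrite -[1]/(1%:C) -rmorphD !euler_gamma_real -rmorphM.
exact: complexI.
Qed.

(** On the interval from 1 to 2 the integrand is at least e^(-2), since u^(a-1) >= 1 there when a >=
    1. *)
Lemma rgamma_gt0 a : 1 <= a -> 0 < rgamma a.
Proof.
move=> a1; have a0 : 0 < a by exact: lt_le_trans a1.
apply: (@lt_le_trans _ _ (expR (- 2))); first exact: expR_gt0.
rewrite -lee_fin (EFin_Rintegral mpos (integrable_rgamma a0)).
have mg := lebesgue_integrable_measurable (integrable_rgamma a0).
have sub12 : (`[1, 2]%classic : set R) `<=` pos.
  by move=> u; rewrite /pos /= !in_itv/= andbT => /andP[u1 _]; exact: lt_le_trans ltr01 u1.
have mg12 : measurable_fun (`[1, 2]%classic : set R) (fun u : R => u `^ (a - 1) * expR (- u)).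
  exact: measurable_funS mg.
have step1 : ((expR (- 2))%:E <=
    \int[mu]_(u in `[1%R, 2%R]) (u `^ (a - 1) * expR (- u))%:E)%E.
  have <- : (\int[mu]_(u in `[1%R, 2%R]) (expR (- 2))%:E = (expR (- 2))%:E)%E.
    rewrite integral_cst//= lebesgue_measure_itv/= lte_fin ltr1n.
    by rewrite -EFinB -EFinM; congr (_%:E); ring.
  apply: ge0_le_integral => //; first exact/measurable_EFinP.
  move=> u; rewrite /= in_itv/= => /andP[u1 u2]; rewrite lee_fin.
  rewrite -[leLHS]mul1r ler_pM ?expR_ge0// ?ler_expR ?lerN2//.
  by have := @ler_powR R u u1 0 (a - 1); rewrite powRr0 subr_ge0; exact.
apply: le_trans step1 _; apply: ge0_subset_integral => //; first exact/measurable_EFinP.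
by move=> u _; rewrite lee_fin mulr_ge0 ?powR_ge0 ?expR_ge0.
Qed.

(** This carries a hypothetical zero to points of arbitrarily large real part. *)
Lemma euler_gammaDn z n : 0 < complex.Re z -> euler_gamma z = 0 ->
  euler_gamma (z + n%:R) = 0.
Proof.
move=> z0 gz; elim: n => [|n ih]; first by rewrite addr0.
rewrite -natr1 addrA euler_gammaS ?ih ?mulr0//.
by rewrite cReD Re_nat ltr_wpDr.
Qed.

(* For W with the Gamma(a) law, ln (W / a) has second moment O(1/a), so
   Gamma(a + iy) a^(-iy) / Gamma(a) tends to 1 as a grows; the functional
   equation brings this back to the initial point. *)
Lemma euler_gamma_neq0 z : 0 < complex.Re z -> euler_gamma z != 0.
Proof.
move=> z0; apply/eqP => gz; pose y := complex.Im z.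
(* This shift makes the new real part a exceed 1 + 2 y^2, which is exactly what makes the final
   lower bound 1 - 2 y^2 / (a - 1) positive. *)
pose n := (Num.truncn (2 * y ^+ 2)).+2.
have gw := euler_gammaDn n z0 gz; move: gw; set w := z + n%:R => gw.
pose a := complex.Re w.
have Imw : complex.Im w = y by rewrite cImD Im_nat addr0.
have ya : 1 + 2 * y ^+ 2 < a.
  have h := truncnS_gt (2 * y ^+ 2).
  by rewrite /a cReD Re_nat /n -addn1 natrD; lra.
clearbody w.
have a1 : 1 < a by rewrite (le_lt_trans _ ya)// lerDl mulr_ge0 ?sqr_ge0.
have a0 : 0 < a by exact: lt_trans a1.
have am0 : 0 < a - 1 by rewrite subr_gt0.
have I0 := integrable_rgamma a0.
have Ip : mu.-integrable pos (EFin \o (fun u => u `^ (a + 1 - 1) * expR (- u))).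
  by apply: integrable_rgamma; rewrite addr_gt0.
have Im := integrable_rgamma am0.
(* The real part of a^(-iy) times the Euler integrand at w; its integral is zero if Gamma vanishes
   at w. *)
pose g u := u `^ (a - 1) * expR (- u) * cos (y * ln (u / a)).
have Cw := cintegrableZ (cpow a (0 -i* y)) mpos (cintegrable_gamma a0).
have gE u : pos u -> complex.Re (cpow a (0 -i* y) *
    (cpow u (w - 1) * (expR (- u))%:C)) = g u.
  move=> /pos_gt0 u0; rewrite /g /cpow !(cReM, cImM, cReD, cImD, cReN, cImN) /= Imw.
  have -> : cos (y * ln (u / a)) =
      cos (y * ln u) * cos (y * ln a) + sin (y * ln u) * sin (y * ln a).
    by rewrite ln_div ?posrE// mulrBr cosB.
  by rewrite (_ : y - 0 = y) ?subr0// powRr0 mulNr sinN cosN -/a; ring.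
have gint : mu.-integrable pos (EFin \o g).
  by have [+ _] := Cw; exact: lebesgue_eq_integrable.
have g0 : (\int[mu]_(u in pos) g u)%R = 0.
  have : complex.Re (cpow a (0 -i* y) * euler_gamma w) = 0 by rewrite gw mulr0.
  rewrite -cintegralZ//; last exact: cintegrable_gamma a0.
  move=> <-; apply: eq_Rintegral => u; rewrite inE => upos.
  exact/esym/gE.
(* Expansion of the Gamma density times 1 - 2 y^2 (u/a + a/u - 2), the lower bound for the cosine
   given by [cos_ge] and [sqr_ln_le]. Its three terms integrate to values of Gamma at a, a + 1 and a
   - 1. *)
pose h u := (1 + 4 * y ^+ 2) * (u `^ (a - 1) * expR (- u)) -
  (2 * y ^+ 2 / a) * (u `^ (a + 1 - 1) * expR (- u)) -
  (2 * y ^+ 2 * a) * (u `^ (a - 1 - 1) * expR (- u)).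
have Z0 := lebesgue_integrableZ (1 + 4 * y ^+ 2) mpos I0.
have Zp := lebesgue_integrableZ (2 * y ^+ 2 / a) mpos Ip.
have Zm := lebesgue_integrableZ (2 * y ^+ 2 * a) mpos Im.
have Z1 := lebesgue_integrableB mpos Z0 Zp.
have hint : mu.-integrable pos (EFin \o h) by exact: lebesgue_integrableB.
have hE : (\int[mu]_(u in pos) h u)%R = rgamma a * (1 - 2 * y ^+ 2 / (a - 1)).
  rewrite /h !RintegralB//.
  rewrite !RintegralZl// -!/(rgamma _) rgammaS//.
  have -> : rgamma a = (a - 1) * rgamma (a - 1) by rewrite -rgammaS// subrK.
  by field; rewrite !gt_eqF.
have hg u : pos u -> h u <= g u.
  move=> /pos_gt0 u0; have ua0 : 0 < u / a by rewrite divr_gt0.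
  have e1 : u `^ (a + 1 - 1) = u `^ (a - 1) * u.
    by rewrite addrAC powRD ?(gt_eqF u0) ?implybT// powRr1// ltW.
  have e2 : u `^ (a - 1 - 1) = u `^ (a - 1) / u.
    by rewrite powRB ?(gt_eqF u0) ?implybT// powRr1// ltW.
  have -> : h u = u `^ (a - 1) * expR (- u) *
      (1 - (y ^+ 2 * (4 * (u / a + (u / a)^-1 - 2))) / 2).
    by rewrite /h e1 e2; field; rewrite !gt_eqF.
  rewrite /g ler_wpM2l ?mulr_ge0 ?powR_ge0 ?expR_ge0//.
  apply: le_trans (cos_ge _); rewrite lerB// ler_pM2r// exprMn.
  by rewrite ler_wpM2l ?sqr_ge0// sqr_ln_le.
have : (\int[mu]_(u in pos) h u)%R <= (\int[mu]_(u in pos) g u)%R.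
  exact: le_Rintegral.
rewrite g0 hE leNgt mulr_gt0 ?rgamma_gt0 ?ltW// subr_gt0 ltr_pdivrMr// mul1r.
by rewrite ltrBrDl.
Qed.

End gamma_function.

(** * Gamma and Poisson integrals along vertical lines *)

Section vertical_lines.
Context {R : realType}.
Let mu := @lebesgue_measure R.
Let pos : set R := `]0, +oo[%classic.

Let pos_gt0 (u : R) : pos u -> 0 < u.
Proof. by rewrite /pos /= in_itv/= andbT. Qed.

Let mpos : measurable pos.
Proof. exact: measurable_itv. Qed.

Let mT : measurable [set: R].
Proof. exact: measurableT. Qed.

Lemma oneDsqr_pos (y : R) : 0 < 1 + y ^+ 2.
Proof. by rewrite ltr_pwDl ?sqr_ge0. Qed.

Lemma continuous_cauchy : continuous (fun y : R => (1 + y ^+ 2)^-1).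
Proof. exact: continuous_oneDsqrV. Qed.

Lemma measurable_cauchy : measurable_fun setT (fun y : R => (1 + y ^+ 2)^-1).
Proof. exact: continuous_measurable_fun continuous_cauchy. Qed.

Lemma integral_cauchy : (\int[mu]_y ((1 + y ^+ 2)^-1)%:E)%E = (pi : R)%:E.
Proof.
rewrite (@ge0_symfun_integralT R (fun y => (1 + y ^+ 2)^-1)).
- have -> : [set x : R | 0 <= x] = `[0, +oo[%classic.
    by apply/seteqP; split => x /=; rewrite in_itv/= andbT.
  by rewrite integral0y_oneDsqr -EFinM; congr (_%:E); field.
- by move=> x; rewrite invr_ge0 ltW// oneDsqr_pos.
- exact: continuous_cauchy.
- by move=> x /=; rewrite sqrrN.
Qed.

Lemma integrable_cauchy : mu.-integrable setT (EFin \o (fun y => (1 + y ^+ 2)^-1)).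
Proof.
apply/integrableP; split.
  by apply/measurable_EFinP; exact: measurable_cauchy.
have <- : (\int[mu]_y ((1 + y ^+ 2)^-1)%:E =
    \int[mu]_x `|(EFin \o (fun y : R => (1 + y ^+ 2)^-1%R)) x|)%E.
  apply: eq_integral => y _ /=; rewrite ger0_norm// invr_ge0 ltW//.
  exact: oneDsqr_pos.
by rewrite integral_cauchy ltry.
Qed.

Lemma integrable_bounded_by_cauchy (C : R) (f : R -> R) : measurable_fun setT f ->
  (forall y, `|f y| <= C / (1 + y ^+ 2)) -> mu.-integrable setT (EFin \o f).
Proof.
move=> mf fC; apply: (lebesgue_integrable_dominated mT mf _
  (lebesgue_integrableZ C mT integrable_cauchy)).
by move=> y _; exact: fC.
Qed.

(** Measurability is read off from Fubini. The weight 1 / (1 + y^2) is inserted to make the double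
    integral converge absolutely, and is divided out afterwards. *)
Lemma cmeasurable_gamma_line (r k : R) : 0 < r ->
  cmeasurable setT (fun y => euler_gamma (r +i* (k * y))).
Proof.
move=> r0.
pose F (y u : R) : R[i] := ((1 + y ^+ 2)^-1)%:C *
  (cpow u ((r +i* (k * y)) - 1) * (expR (- u))%:C).
have mF : cmeasurable (setT `*` pos) (fun z : R * R => F z.1 z.2).
  apply: cmeasurableM.
    apply: cmeasurable_real; apply: measurable_funTS.
    exact: (measurableT_comp measurable_cauchy measurable_fst).
  apply: cmeasurableM.
    apply: (@cmeasurable_cpow _ _ _ _ (r - 1)).
    - by apply: measurable_funTS; exact: measurable_snd.
    - by [].
    - apply: measurable_funTS => /=; apply: measurable_funB; last exact: measurable_cst.
      by apply: measurable_funM; [exact: measurable_cst|exact: measurable_fst].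
  apply: cmeasurable_real; apply: measurable_funTS.
  apply: measurableT_comp; first exact: measurable_expR.
  by apply: measurableT_comp => //; exact: measurable_snd.
have [|_] := cfubini mT mpos integrable_cauchy (integrable_rgamma r0) mF.
  move=> y u _ _; rewrite /F ComplexField.Normc.normcM normc_real.
  rewrite normc_gamma_integrand ger0_norm//.
  by rewrite invr_ge0 ltW// oneDsqr_pos.
move=> /cintegrable_measurable mG.
have m1 : cmeasurable setT (fun y : R => (1 + y ^+ 2)%:C).
  by apply: cmeasurable_real; apply: measurable_funD => //; exact: measurable_funX.
have := cmeasurableM m1 mG; congr cmeasurable; apply/funext => y.
rewrite /F cintegralZ//; last exact: cintegrable_gamma.
rewrite mulrA -rmorphM divff ?mul1r//.
by rewrite gt_eqF// oneDsqr_pos.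
Qed.

(* The functional equation applied twice, Gamma z = Gamma (z + 2) / (z (z + 1)),
   trades a bounded factor for quadratic decay. *)
Lemma gamma_line_decay (r k : R) : 0 < r -> 0 < k ->
  exists C, forall y, normc (euler_gamma (r +i* (k * y))) <= C / (1 + y ^+ 2).
Proof.
(* The first factor bounds Gamma (z + 2) on the line; the second converts |z|^2 = r^2 + k^2 y^2 into
   1 + y^2, as checked in [h3]. *)
move=> r0 k0; exists (2 * rgamma (r + 1 + 1) * (r ^- 2 + k ^- 2)) => y.
set z := r +i* (k * y).
have z0 : 0 < complex.Re z by [].
have z10 : 0 < complex.Re (z + 1) by rewrite cReD addr_gt0.
have E : euler_gamma (z + 1 + 1) = (z + 1) * (z * euler_gamma z).
  by rewrite euler_gammaS// euler_gammaS.
have h := normc_euler_gamma_le (_ : 0 < complex.Re (z + 1 + 1)).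
have {h} : normc (euler_gamma (z + 1 + 1)) <= 2 * rgamma (r + 1 + 1).
  by rewrite -[r + 1 + 1]/(complex.Re (z + 1 + 1)); apply: h; rewrite cReD addr_gt0.
rewrite E !ComplexField.Normc.normcM => h.
have q0 : 0 < r ^+ 2 + (k * y) ^+ 2 by rewrite ltr_pwDl ?exprn_gt0 ?sqr_ge0.
have nz : normc z ^+ 2 = r ^+ 2 + (k * y) ^+ 2 by rewrite /z /= sqr_sqrtr ?ltW.
(* Hence |z (z + 1)| is at least |z|^2, which is known exactly. *)
have nz1 : normc z <= normc (z + 1).
  rewrite /z /= addr0 ler_sqrt; last by rewrite addr_ge0 ?sqr_ge0.
  by rewrite lerD2r ler_sqr ?nnegrE ?addr_ge0 ?ltW// ltrDl.
have h2 : (r ^+ 2 + (k * y) ^+ 2) * normc (euler_gamma z) <= 2 * rgamma (r + 1 + 1).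
  apply: le_trans h; rewrite mulrA ler_wpM2r ?normc_ge0// -nz expr2.
  by rewrite ler_wpM2r ?normc_ge0.
have h3 : 1 + y ^+ 2 <= (r ^- 2 + k ^- 2) * (r ^+ 2 + (k * y) ^+ 2).
  have -> : (r ^- 2 + k ^- 2) * (r ^+ 2 + (k * y) ^+ 2) =
     1 + y ^+ 2 + ((r / k) ^+ 2 + (k * y / r) ^+ 2) by field; rewrite !gt_eqF.
  by rewrite lerDl addr_ge0 ?sqr_ge0.
rewrite ler_pdivlMr ?oneDsqr_pos//.
apply: (@le_trans _ _ (normc (euler_gamma z) *
    ((r ^- 2 + k ^- 2) * (r ^+ 2 + (k * y) ^+ 2)))).
  by rewrite ler_wpM2l ?normc_ge0.
rewrite mulrCA [leLHS]mulrC ler_wpM2r ?addr_ge0 ?invr_ge0 ?sqr_ge0//.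
by rewrite mulrC.
Qed.

(** The 4 is b^b for b = 2 in [powR_le_expR], which gives (e |y|)^2 <= 4 e^(e |y|) when y is
    nonzero. *)
Lemma laplace_le_cauchy (e y : R) : 0 < e ->
  expR (- (e * `|y|)) <= (1 + 4 / e ^+ 2) / (1 + y ^+ 2).
Proof.
move=> e0; rewrite expRN ler_pdivlMr ?oneDsqr_pos// mulrC ler_pdivrMr ?expR_gt0//.
set q := expR _; have -> : (1 + 4 / e ^+ 2) * q = q + 4 / e ^+ 2 * q by ring.
rewrite {}/q lerD//; first by rewrite -expR0 ler_expR mulr_ge0 ?normr_ge0 ?(ltW e0).
have [->|y0] := eqVneq y 0; first by rewrite expr0n/= mulr_ge0 ?divr_ge0 ?sqr_ge0 ?expR_ge0.
have ey0 : 0 < e * `|y| by rewrite mulr_gt0// normr_gt0.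
have := @powR_le_expR R 2 _ (ltr0n _ 2) ey0.
have -> : (e * `|y|) `^ 2 = e ^+ 2 * y ^+ 2.
  by rewrite (powR_mulrn 2) ?(ltW ey0)// exprMn real_normK ?num_real.
have -> : (2 : R) `^ 2 = 4 by rewrite (powR_mulrn 2)// -natrX.
move=> h.
by rewrite mulrAC ler_pdivlMr ?exprn_gt0// mulrC.
Qed.

Lemma cmeasurable_cis (f : R -> R) (D : set R) : measurable_fun D f ->
  cmeasurable D (fun y => cos (f y) +i* sin (f y)).
Proof.
move=> mf; split => /=.
  exact: (measurableT_comp (continuous_measurable_fun (@continuous_cos R)) mf).
exact: (measurableT_comp (continuous_measurable_fun (@continuous_sin R)) mf).
Qed.

Lemma normc_cis (t : R) : normc (cos t +i* sin t) = 1.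
Proof. by rewrite /= cos2Dsin2 sqrtr1. Qed.

Lemma measurable_laplace (e : R) : measurable_fun setT (fun y : R => expR (- (e * `|y|))).
Proof.
apply: measurableT_comp => //; apply: measurableT_comp => //.
by apply: measurable_funM; [exact: measurable_cst|exact: continuous_measurable_fun (@norm_continuous _ _)].
Qed.

Lemma integrable_laplace (e : R) : 0 < e ->
  mu.-integrable setT (EFin \o (fun y => expR (- (e * `|y|)))).
Proof.
move=> e0; apply: (@integrable_bounded_by_cauchy (1 + 4 / e ^+ 2)).
  exact: measurable_laplace.
by move=> y; rewrite ger0_norm ?expR_ge0// laplace_le_cauchy.
Qed.

(** This is the complex exponential e^(w y) of a real variable y. *)
Let E (w : R[i]) (y : R) : R[i] := (expR (complex.Re w * y))%:C *
  (cos (complex.Im w * y) +i* sin (complex.Im w * y)).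

Let cderiveE w y : cderive (E w) y (w * E w y).
Proof.
apply: cderive_eq (cderiveM (cderive_real (is_derive_expRM _ _))
  (cderive_cis (is_derive_mulr_cst _ _))) _.
rewrite /E; case: w => a b; apply: eq_ReIm; rewrite !(cReM, cImM, cReD, cImD) /=; ring.
Qed.

Let normE w y : normc (E w y) = expR (complex.Re w * y).
Proof.
by rewrite ComplexField.Normc.normcM normc_cis mulr1 normc_real ger0_norm ?expR_ge0.
Qed.

Let E0 w : E w 0 = 1.
Proof. by rewrite /E !mulr0 expR0 cos0 sin0 mul1r. Qed.

Let cvg_inv : (n.+2%:R : R)^-1 @[n --> \oo] --> 0.
Proof.
have := @cvg_harmonic R; rewrite -(cvg_shiftS (@harmonic R)).
exact.
Qed.

Let cvgE0 w (p : R[i] -> R) :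
  {for 0, continuous (fun y => p (E w y))} ->
  p (E w n.+2%:R^-1) @[n --> \oo] --> p 1 /\
  p (E w (- n.+2%:R^-1)) @[n --> \oo] --> p 1.
Proof.
rewrite /prop_for /continuous_at E0 => cp.
have cvg_invN : - (n.+2%:R : R)^-1 @[n --> \oo] --> 0.
  by rewrite -oppr0; apply: cvgN.
by split; [exact: (cvg_comp _ _ cvg_inv cp)|exact: (cvg_comp _ _ cvg_invN cp)].
Qed.

(** Here [p] stands for the real or the imaginary part, and the sign of [s] selects the end of the
    line; the decay follows from e^(-t) <= 1 / t. *)
Let cvgEy w (s : R) (p : R[i] -> R) : (forall z, `|p z| <= normc z) ->
  complex.Re w * s < 0 -> p (E w (s * n.+2%:R)) @[n --> \oo] --> 0.
Proof.
move=> pn ws; apply/norm_cvg0P.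
apply: (@squeeze_cvgr _ _ _ _ (cst 0) (fun n => (- (complex.Re w * s))^-1 * n.+2%:R^-1)).
- apply: nearW => n; rewrite normr_ge0 /= (le_trans (pn _))// normE mulrA.
  set t := complex.Re w * s in ws *; clearbody t.
  have t0 : 0 < - t * n.+2%:R by rewrite mulr_gt0// oppr_gt0.
  rewrite -invfM -[t * _]opprK expRN lef_pV2 ?posrE ?expR_gt0// -mulNr.
  by rewrite (le_trans _ (expR_ge1Dx _))// lerDr.
- exact: cvg_cst.
- by rewrite -[X in _ --> X](mulr0 (- (complex.Re w * s))^-1); apply: cvgM => //; exact: cvg_cst.
Qed.

Lemma cintegral_split (f : R -> R[i]) : cintegrable setT f ->
  cintegral setT f = cintegral `]-oo, 0[%classic f + cintegral pos f.
Proof.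
move=> [f1 f2].
have h (g : R -> R) : mu.-integrable setT (EFin \o g) ->
    (\int[mu]_x g x = \int[mu]_(x in `]-oo, 0[) g x + \int[mu]_(x in pos) g x)%R.
  move=> gi; rewrite /pos Rintegral_itv_obnd_cbnd; last exact: integrableS gi.
  have -> : [set: R] = `]-oo, 0[%classic `|` `[0, +oo[%classic.
    by rewrite itv_setU_setT.
  rewrite Rintegral_setU//; first by rewrite itv_setU_setT.
  rewrite disj_set2E; apply/eqP; rewrite -subset0 => x []/= /[!in_itv]/=.
  by rewrite andbT ltNge => /negP.
by apply: eq_ReIm; rewrite (cReD, cImD) /= h.
Qed.

Lemma poisson_integral (e v : R) : 0 < e ->
  cintegral setT (fun y => (expR (- (e * `|y|)))%:C * (cos (v * y) +i* sin (v * y)))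
  = (2 * e / (e ^+ 2 + v ^+ 2))%:C.
Proof.
move=> e0; pose f (y : R) : R[i] := (expR (- (e * `|y|)))%:C * (cos (v * y) +i* sin (v * y)).
have mf : cmeasurable setT f.
  apply: cmeasurableM; first by apply: cmeasurable_real; exact: measurable_laplace.
  by apply: cmeasurable_cis; apply: measurable_funM => //; exact: measurable_cst.
have fint : cintegrable setT f.
  apply: (dominated_cintegrable mT mf _ (integrable_laplace e0)) => y _.
  by rewrite ComplexField.Normc.normcM normc_cis mulr1 normc_real ger0_norm ?expR_ge0.
pose neg : set R := `]-oo, 0[%classic.
have mneg : measurable neg by exact: measurable_itv.
have sub_int (D : set R) : measurable D -> cintegrable D f.
  by move=> mD; have [f1 f2] := fint; split; [apply: integrableS f1|apply: integrableS f2].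
(* On each half-line the integrand is a pure exponential, with exponent [wp] on the right and [wn]
   on the left. The half-line integrals are -1 / [wp] and 1 / [wn], and [wp * wn] = -(e^2 + v^2). *)
pose wp : R[i] := (- e) +i* v; pose wn : R[i] := e +i* v.
have cE w y : {for y, continuous (fun y => complex.Re (E w y))} /\
    {for y, continuous (fun y => complex.Im (E w y))}.
  by have [/is_derive_continuous ? /is_derive_continuous ?] := cderiveE w y.
have dwE w y : exists df, cderive (fun y => w * E w y) y df.
  by eexists; exact: (cderiveM (cderive_cst w y) (cderiveE w y)).
have fp y : pos y -> f y = E wp y.
  by move=> /pos_gt0 y0; rewrite /f /E /= gtr0_norm// mulNr.
have fn y : neg y -> f y = E wn y.
  by rewrite /neg /= in_itv/= => y0; rewrite /f /E /= ltr0_norm// mulrN opprK.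
have intE_p : cintegrable pos (fun y => E wp y) by exact: eq_cintegrable fp (sub_int _ mpos).
have intE_n : cintegrable neg (fun y => E wn y) by exact: eq_cintegrable fn (sub_int _ mneg).
have Jp : wp * cintegral pos (E wp) = - 1.
  rewrite -cintegralZ//.
  apply: (@improper_cFTC2 R _ _ _ (E wp) _ (- 1) pos_lt pos_ninc pos_ndec pos_exhaustion).
  - by move=> y _; exact: cderiveE.
  - by move=> y _; exact: dwE.
  - exact: cintegrableZ.
  - rewrite -[complex.Re (-1)]add0r; apply: cvgB; last by have [] := cvgE0 (cE wp 0).1.
    have := @cvgEy wp 1 _ (@Re_le_normc _); rewrite /= mulr1 oppr_lt0 => /(_ e0).
    by under eq_fun do rewrite mul1r.
  - rewrite -[complex.Im (-1)]add0r; apply: cvgB; last by have [] := cvgE0 (cE wp 0).2.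
    have := @cvgEy wp 1 _ (@Im_le_normc _); rewrite /= mulr1 oppr_lt0 => /(_ e0).
    by under eq_fun do rewrite mul1r.
have neg_lt n : - (n.+2%:R : R) < - n.+2%:R^-1 by rewrite ltrN2 pos_lt.
have neg_ninc : {homo (fun n => - (n.+2%:R : R)) : m n / (m <= n)%N >-> n <= m}.
  by move=> m n mn; rewrite lerN2 pos_ndec.
have neg_ndec : {homo (fun n => - (n.+2%:R : R)^-1) : m n / (m <= n)%N >-> m <= n}.
  by move=> m n mn; rewrite lerN2 pos_ninc.
have Jn : wn * cintegral neg (E wn) = 1.
  rewrite -cintegralZ//.
  apply: (@improper_cFTC2 R _ _ _ (E wn) _ 1 neg_lt neg_ninc neg_ndec neg_exhaustion).
  - by move=> y _; exact: cderiveE.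
  - by move=> y _; exact: dwE.
  - exact: cintegrableZ.
  - rewrite -[complex.Re 1]subr0; apply: cvgB; first by have [] := cvgE0 (cE wn 0).1.
    have := @cvgEy wn (- 1) _ (@Re_le_normc _); rewrite /= mulrN1 oppr_lt0 => /(_ e0).
    by under eq_fun do rewrite mulN1r.
  - rewrite -[complex.Im 1]subr0; apply: cvgB; first by have [] := cvgE0 (cE wn 0).2.
    have := @cvgEy wn (- 1) _ (@Im_le_normc _); rewrite /= mulrN1 oppr_lt0 => /(_ e0).
    by under eq_fun do rewrite mulN1r.
have n0 : e ^+ 2 + v ^+ 2 != 0 by rewrite gt_eqF// ltr_pwDl ?exprn_gt0 ?sqr_ge0.
rewrite -/f cintegral_split// (eq_cintegral fn) (eq_cintegral fp).
have wp0 : wp != 0 by apply/eqP => -[/eqP]; rewrite oppr_eq0 (gt_eqF e0).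
have wn0 : wn != 0 by apply/eqP => -[/eqP]; rewrite (gt_eqF e0).
apply: (mulfI (mulf_neq0 wp0 wn0)).
rewrite mulrDr -[X in X + _]mulrA Jn mulr1 [wp * wn]mulrC -[X in _ + X]mulrA Jp.
apply: eq_ReIm; rewrite !(cReM, cImM, cReD, cImD, cReN, cImN) /=; field; exact: n0.
Qed.

End vertical_lines.

Section complex_parts_real.
Context {R : realType}.
Implicit Types (r : R) (z : R[i]).

Lemma cReZ r z : complex.Re (r%:C * z) = r * complex.Re z.
Proof. by rewrite cReM /= mul0r subr0. Qed.

Lemma cImZ r z : complex.Im (r%:C * z) = r * complex.Im z.
Proof. by rewrite cImM /= mul0r addr0. Qed.

Lemma Re_cintegral (D : set R) (f : R -> R[i]) : complex.Re (cintegral D f) =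
  (\int[@lebesgue_measure R]_(x in D) complex.Re (f x))%R.
Proof. by []. Qed.

Lemma Im_cintegral (D : set R) (f : R -> R[i]) : complex.Im (cintegral D f) =
  (\int[@lebesgue_measure R]_(x in D) complex.Im (f x))%R.
Proof. by []. Qed.

End complex_parts_real.

Section dominated_real.
Context {R : realType}.
Let mu := @lebesgue_measure R.

Lemma Rintegral_dominated_cvg (D : set R) (f_ : nat -> R -> R) (f g : R -> R) :
  measurable D -> (forall n, measurable_fun D (f_ n)) ->
  (forall x, D x -> f_ n x @[n --> \oo] --> f x) ->
  mu.-integrable D (EFin \o g) ->
  (forall n x, D x -> `|f_ n x| <= g x) ->
  (\int[mu]_(x in D) f_ n x)%R @[n --> \oo] --> (\int[mu]_(x in D) f x)%R.
Proof.
move=> mD mf ff gi fg.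
have mf' n : measurable_fun D (EFin \o f_ n) by exact/measurable_EFinP.
have ff' x : D x -> (EFin \o f_ n) x @[n --> \oo] --> (f x)%:E.
  by move=> Dx; apply: cvg_EFin; [exact: nearW|exact: ff].
have fg' n x : D x -> (`|(EFin \o f_ n) x| <= (EFin \o g) x)%E.
  by move=> Dx; rewrite /= lee_fin; exact: fg.
have mDD : measurable (D : set (measurableTypeR R)) by [].
have mf0 : measurable_fun D (EFin \o f).
  by apply/measurable_EFinP; exact: (measurable_fun_cvg mf ff).
have [fi _ cv] := dominated_convergence mDD mf' mf0 (aeW mu ff') gi
  (aeW mu (fun x n => @fg' n x)).
by apply: fine_cvg; rewrite (EFin_Rintegral mD fi).
Qed.

End dominated_real.

(** * The Cahen-Mellin and Mellin-Barnes integrals *)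

Section cahen_mellin.
Context {R : realType}.
Let mu := @lebesgue_measure R.
Let pos : set R := `]0, +oo[%classic.

Let pos_gt0 (u : R) : pos u -> 0 < u.
Proof. by rewrite /pos /= in_itv/= andbT. Qed.

Let mpos : measurable pos.
Proof. exact: measurable_itv. Qed.

Let mT : measurable [set: R].
Proof. exact: measurableT. Qed.

Variables (tau c : R).
Hypotheses (tau0 : 0 < tau) (c0 : 0 < c).

(** The argument ct of the Gamma factor at the point t = tau + i y of the line. *)
Let w (y : R) : R[i] := (c * tau) +i* (c * y).
Let ct0 : 0 < c * tau. Proof. exact: mulr_gt0. Qed.

Lemma cmeasurable_cpow_line (x r k : R) :
  cmeasurable setT (fun y => cpow x (r +i* (k * y))).
Proof.
apply: (@cmeasurable_cpow _ _ _ _ r) => //=.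
by apply: measurable_funM => //; exact: measurable_cst.
Qed.

Section inversion.
Variables (x : R).
Hypothesis (x0 : 0 < x).

Let G y := euler_gamma (w y) * cpow x (- w y).

Let cpow_NwE y : cpow x (- w y) = cpow x ((- (c * tau)) +i* (- c * y)).
Proof. by congr cpow; rewrite /w; apply: eq_ReIm => //=; rewrite mulNr. Qed.

Let mG : cmeasurable setT G.
Proof.
apply: cmeasurableM; first exact: cmeasurable_gamma_line.
under eq_fun do rewrite cpow_NwE.
exact: cmeasurable_cpow_line.
Qed.

Lemma cintegrable_cahen_mellin :
  cintegrable setT (fun y => euler_gamma (w y) * cpow x (- w y)).
Proof.
have [C hC] := gamma_line_decay ct0 c0.
apply: (dominated_cintegrable mT mG _
  (lebesgue_integrableZ (C * x `^ (- (c * tau))) mT integrable_cauchy)).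
move=> y _; rewrite /G ComplexField.Normc.normcM normc_cpow cReN /= mulrAC.
by rewrite ler_wpM2r ?powR_ge0// hC.
Qed.

Let kernel (e u : R) := u^-1 * expR (- u) * (u / x) `^ (c * tau) *
  (2 * e / (e ^+ 2 + (c * ln (u / x)) ^+ 2)).

(* Abel summation: the factor e^(-e |y|) makes the double integral absolutely
   convergent, and the y-integral becomes a Poisson kernel in ln (u / x). *)
Let damped (e : R) : 0 < e ->
  cintegral setT (fun y => (expR (- (e * `|y|)))%:C * G y) =
  ((\int[mu]_(u in pos) kernel e u)%R)%:C.
Proof.
move=> e0.
pose F (y u : R) : R[i] := ((expR (- (e * `|y|)))%:C * cpow x (- w y)) *
  (cpow u (w y - 1) * (expR (- u))%:C).
pose A u := u^-1 * expR (- u) * (u / x) `^ (c * tau).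
pose f u (y : R) : R[i] := (expR (- (e * `|y|)))%:C *
  (cos (c * ln (u / x) * y) +i* sin (c * ln (u / x) * y)).
have innerE y : cintegral pos (F y) = (expR (- (e * `|y|)))%:C * G y.
  rewrite /F cintegralZ //; last exact: cintegrable_gamma.
  by rewrite /G -mulrA; congr (_ * _); exact: mulrC.
(* Merging u^w and x^(-w) into (u/x)^w separates a modulus free of y from the phase c ln (u/x) y,
   which is the integrand of [poisson_integral]. *)
have FfE u y : 0 < u -> F y u = (A u)%:C * f u y.
  move=> u0; rewrite /F /f /A.
  have -> : cpow u (w y - 1) = cpow u (w y) * (u^-1)%:C.
    by rewrite cpowD // cpowN1.
  have -> : cpow x (- w y) = cpow x^-1 (w y) by rewrite cpow_inv.
  have E : cpow u (w y) * cpow x^-1 (w y) = ((u / x) `^ (c * tau))%:C *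
      (cos (c * ln (u / x) * y) +i* sin (c * ln (u / x) * y)).
    rewrite -cpow_mul ?invr_gt0 // /cpow /=.
    by rewrite [c * y * _]mulrAC.
  rewrite !rmorphM /=.
  transitivity (cpow u (w y) * cpow x^-1 (w y) *
    ((expR (- (e * `|y|)))%:C * (u^-1)%:C * (expR (- u))%:C)); first by ring.
  by rewrite E; ring.
have f_int u : cintegrable setT (f u).
  have mf : cmeasurable setT (f u).
    apply: cmeasurableM; first by apply: cmeasurable_real; exact: measurable_laplace.
    by apply: cmeasurable_cis; apply: measurable_funM => //; exact: measurable_cst.
  apply: (dominated_cintegrable mT mf _ (integrable_laplace e0)) => y _.
  by rewrite ComplexField.Normc.normcM normc_cis mulr1 normc_real ger0_norm ?expR_ge0.
have outerE u : 0 < u -> cintegral setT (F ^~ u) = (kernel e u)%:C.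
  move=> u0; rewrite (@eq_cintegral _ _ _ (fun y => (A u)%:C * f u y)); last first.
    by move=> y _; exact: FfE.
  by rewrite cintegralZ // poisson_integral // -rmorphM.
have mF : cmeasurable (setT `*` pos) (fun z : R * R => F z.1 z.2).
  apply: cmeasurableM; last apply: cmeasurableM.
  - have [m1 m2] : cmeasurable setT (fun y : R => (expR (- (e * `|y|)))%:C * cpow x (- w y)).
      apply: cmeasurableM; first by apply: cmeasurable_real; exact: measurable_laplace.
      by under eq_fun do rewrite cpow_NwE; exact: cmeasurable_cpow_line.
    split; apply: measurable_funTS.
      exact: (measurableT_comp m1 measurable_fst).
    exact: (measurableT_comp m2 measurable_fst).
  - apply: (@cmeasurable_cpow _ _ _ _ (c * tau - 1)).
    + by apply: measurable_funTS; exact: measurable_snd.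
    + by [].
    + apply: measurable_funTS => /=; apply: measurable_funB; last exact: measurable_cst.
      by apply: measurable_funM; [exact: measurable_cst|exact: measurable_fst].
  - apply: cmeasurable_real; apply: measurable_funTS.
    apply: measurableT_comp; first exact: measurable_expR.
    by apply: measurableT_comp => //; exact: measurable_snd.
have qint := lebesgue_integrableZ (x `^ (- (c * tau))) mpos (integrable_rgamma ct0).
have Fpq y u : [set: R] y -> pos u -> normc (F y u) <=
    expR (- (e * `|y|)) * (x `^ (- (c * tau)) * (u `^ (c * tau - 1) * expR (- u))).
  move=> _ _; rewrite /F ComplexField.Normc.normcM normc_gamma_integrand.
  rewrite ComplexField.Normc.normcM normc_real normc_cpow cReN /= ger0_norm ?expR_ge0 //.
  by rewrite mulrA.
transitivity (cintegral setT (fun y => cintegral pos (F y))).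
  by apply: eq_cintegral => y _; rewrite innerE.
rewrite (cfubini mT mpos (integrable_laplace e0) qint mF Fpq).1 -cintegral_real.
by apply: eq_cintegral => u /pos_gt0; exact: outerE.
Qed.

(* The kernel after the substitution u = x e^(e r / c), under which the Poisson
   kernel becomes the Cauchy density. *)
Let profile (e r : R) := 2 / c * (expR (- (x * expR (e / c * r))) * expR (tau * (e * r)))
  * (1 + r ^+ 2)^-1.

Let kernel_profile (e : R) : 0 < e ->
  (\int[mu]_(u in pos) kernel e u)%R = (\int[mu]_r profile e r)%R.
Proof.
move=> e0; have ec0 : 0 < e / c by rewrite divr_gt0.
pose phi (r : R) := x * expR (e / c * r); pose dphi (r : R) := x * (e / c * expR (e / c * r)).
have phi0 r : 0 < phi r by rewrite mulr_gt0 ?expR_gt0.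
have dphiE (r : R) : is_derive r 1 phi (dphi r).
  apply: is_derive_eq (is_derive_mul (is_derive_cst x r 1) (is_derive_expRM _ _)) _.
  by rewrite /cst mul0r add0r.
have phi_lt r s : r < s -> phi r < phi s.
  by move=> rs; rewrite ltr_pM2l// ltr_expR ltr_pM2l.
have phi_le r s : r <= s -> phi r <= phi s.
  by move=> rs; rewrite ler_pM2l// ler_expR ler_pM2l.
have posE : pos = \bigcup_n `[phi (- n.+1%:R), phi n.+1%:R]%classic.
  apply/seteqP; split => [u /pos_gt0 u0|u [n _]]; last first.
    by rewrite /pos /= !in_itv/= andbT => /andP[+ _]; exact: lt_le_trans.
  have : [set: R] (ln (u / x) / (e / c)) by [].
  rewrite real_exhaustion => -[n _ /=]; rewrite in_itv/= => /andP[h1 h2].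
  have uE : u = phi (ln (u / x) / (e / c)).
    rewrite /phi mulrCA divff ?gt_eqF// mulr1 lnK ?posrE ?divr_gt0//.
    by rewrite mulrCA divff ?gt_eqF// mulr1.
  by exists n => //=; rewrite in_itv/= uE !phi_le.
rewrite /Rintegral; congr fine.
rewrite (@improper_substitution R _ _ setT pos phi dphi (kernel e) real_lt
  real_ninc real_ndec real_exhaustion posE).
- apply: eq_integral => r _; congr (_%:E); rewrite /kernel /profile /dphi.
  have pne : phi r != 0 by rewrite gt_eqF.
  have Q : phi r / x = expR (e / c * r) by rewrite /phi mulrAC divff ?mul1r// gt_eqF.
  rewrite Q expRK -expRM; have -> : e / c * r * (c * tau) = tau * (e * r).
    by field; rewrite gt_eqF.
  (* The common factor e^2 cancels the e of the Poisson kernel and the e of the Jacobian, so the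
     profile has a nondegenerate limit as e tends to 0. *)
  have D : e ^+ 2 + (c * (e / c * r)) ^+ 2 = e ^+ 2 * (1 + r ^+ 2).
    by field; rewrite gt_eqF.
  rewrite D -/(phi r); have -> : x * (e / c * expR (e / c * r)) = e / c * phi r.
    by rewrite /phi mulrCA.
  have ne := oneDsqr_pos r.
  by field; rewrite pne !gt_eqF.
- move=> r _; apply: (@is_derive_continuous _ _ _ (x * (e / c * (e / c * expR (e / c * r))))).
  apply: is_derive_eq (is_derive_mul (is_derive_cst x r 1)
    (is_derive_mul (is_derive_cst (e / c) r 1) (is_derive_expRM _ _))) _.
  by rewrite /cst !mul0r !add0r.
- by move=> r _; rewrite /dphi ltW // !mulr_gt0 ?expR_gt0 ?invr_gt0.
- by move=> r s _ _; exact: phi_lt.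
- move=> u /pos_gt0 u0; have ux0 : 0 < u / x by rewrite divr_gt0.
  have cdiv : {for u, continuous (fun u : R => u / x)}.
    by apply: cvgM; [exact: cvg_id|exact: cvg_cst].
  have cln : {for u, continuous (fun u : R => ln (u / x))}.
    by apply: (@continuous_comp _ _ _ (fun u : R => u / x) (@ln R)) => //; exact: continuous_ln.
  apply: cvgM; first apply: cvgM; first apply: cvgM.
  + by apply: cvgV; [rewrite gt_eqF|exact: cvg_id].
  + by apply: (@continuous_comp _ _ _ -%R expR); [exact: opp_continuous|exact: continuous_expR].
  + apply: (@continuous_comp _ _ _ (fun u : R => u / x) (fun v => v `^ (c * tau))) => //.
    by have /is_derive_continuous := is_derive1_powR (c * tau) ux0.
  + apply: cvgM; first exact: cvg_cst.
    apply: cvgV; first by rewrite gt_eqF// ltr_pwDl ?exprn_gt0 ?sqr_ge0.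
    apply: cvgD; first exact: cvg_cst.
    apply: (@continuous_comp _ _ _ (fun u : R => c * ln (u / x)) (fun v => v ^+ 2)).
      by apply: cvgM; [exact: cvg_cst|exact: cln].
    exact: exprn_continuous.
- move=> u /pos_gt0 u0.
  by rewrite /kernel !mulr_ge0 ?invr_ge0 ?powR_ge0 ?expR_ge0 ?addr_ge0 ?sqr_ge0//; exact: ltW.
Qed.

(** Let e tend to 0 in [damped]. The left side loses its damping by dominated convergence; on the
    right the profile tends to (2 / c) e^(-x) / (1 + r^2), whose integral brings in pi. *)
Lemma cahen_mellin :
  cintegral setT (fun y => euler_gamma (w y) * cpow x (- w y)) =
  (2 * pi / c * expR (- x))%:C.
Proof.
have Gint := cintegrable_cahen_mellin.
pose e n : R := n.+1%:R^-1.
have e0 n : 0 < e n by rewrite invr_gt0.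
have e_cvg : e n @[n --> \oo] --> 0 by exact: cvg_harmonic.
have e_mul (t : R) : e n * t @[n --> \oo] --> 0.
  by rewrite -[X in _ --> X](mul0r t); apply: cvgM => //; exact: cvg_cst.
have exp_cvg (h : R^nat) : h n @[n --> \oo] --> 0 -> expR (h n) @[n --> \oo] --> (1 : R).
  move=> h0; rewrite -[X in _ --> X](@expR0 R).
  by apply: (cvg_comp _ _ h0); exact: continuous_expR.
have damp_cvg (k : R -> R) : mu.-integrable setT (EFin \o k) ->
    (\int[mu]_y (expR (- (e n * `|y|)) * k y))%R @[n --> \oo] --> (\int[mu]_y k y)%R.
  move=> ki; apply: (@Rintegral_dominated_cvg _ _ _ _ (fun y => `|k y|)) => //.
  - move=> n; apply: measurable_funM; first exact: measurable_laplace.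
    exact: lebesgue_integrable_measurable ki.
  - move=> y _; rewrite -[X in _ --> X]mul1r; apply: cvgM; last exact: cvg_cst.
    by apply: exp_cvg; rewrite -oppr0; apply: cvgN.
  - exact: integrable_norm.
  - move=> n y _; rewrite normrM ger0_norm ?expR_ge0// ler_piMl//.
    by rewrite -expR0 ler_expR oppr_le0 mulr_ge0// ltW.
have profile_cvg : (\int[mu]_r profile (e n) r)%R @[n --> \oo] -->
    (\int[mu]_r (2 / c * expR (- x) * (1 + r ^+ 2)^-1))%R.
  pose M := 2 / c * ((c * tau) `^ (c * tau) * x `^ (- (c * tau))).
  apply: (@Rintegral_dominated_cvg _ _ _ _ (fun r => M * (1 + r ^+ 2)^-1)) => //.
  - move=> n; apply: measurable_funM; last exact: measurable_cauchy.
    have mM (k : R) : measurable_fun setT (fun r : R => k * r).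
      by apply: measurable_funM => //; exact: measurable_cst.
    apply: measurable_funM; first exact: measurable_cst.
    apply: measurable_funM.
      apply: measurableT_comp => //; apply: measurableT_comp => //.
      apply: measurable_funM; first exact: measurable_cst.
      by apply: measurableT_comp.
    by apply: measurableT_comp => //; exact: (measurableT_comp (mM tau) (mM (e n))).
  - move=> r _; apply: cvgM; last exact: cvg_cst.
    apply: cvgM; first exact: cvg_cst.
    rewrite -[X in _ --> X]mulr1; apply: cvgM; last first.
      by apply: exp_cvg; rewrite -(mulr0 tau); apply: cvgM; [exact: cvg_cst|exact: e_mul].
    have : - (x * expR (e n / c * r)) @[n --> \oo] --> - x.
      apply: cvgN; rewrite -[X in _ --> X]mulr1; apply: cvgM; first exact: cvg_cst.
      by apply: exp_cvg; under eq_fun do rewrite -mulrA; exact: e_mul.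
    by move=> h; apply: (cvg_comp _ _ h); exact: continuous_expR.
  - exact: (lebesgue_integrableZ M mT integrable_cauchy).
  - move=> n r _; rewrite /profile /M ger0_norm; last first.
      apply: mulr_ge0; last by rewrite invr_ge0 ltW // oneDsqr_pos.
      by apply: mulr_ge0; [rewrite divr_ge0 // ltW|rewrite mulr_ge0 ?expR_ge0].
    apply: ler_wpM2r; first by rewrite invr_ge0 ltW // oneDsqr_pos.
    apply: ler_wpM2l; first by rewrite divr_ge0 // ltW.
    set q := expR (e n / c * r).
    have xq0 : 0 < x * q by rewrite mulr_gt0 ?expR_gt0.
    (* The growing factor is a power of the same quantity x q that occurs in the decaying
       exponential, so [powR_le_expR] bounds their product uniformly in n. *)
    have -> : expR (tau * (e n * r)) = (x * q) `^ (c * tau) * x `^ (- (c * tau)).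
      rewrite powRM ?expR_ge0 ?ltW// mulrAC -powRD ?subrr ?(gt_eqF x0) ?implybT//.
      by rewrite powRr0 mul1r /q -expRM; congr expR; field; rewrite gt_eqF.
    rewrite mulrA ler_wpM2r ?powR_ge0// expRN mulrC ler_pdivrMr ?expR_gt0//.
    exact: powR_le_expR.
have dampE n := damped (e0 n).
have lim0 : (\int[mu]_r (2 / c * expR (- x) * (1 + r ^+ 2)^-1))%R = 2 * pi / c * expR (- x).
  rewrite RintegralZl//; last exact: integrable_cauchy.
  rewrite /Rintegral integral_cauchy /=; ring.
have [G1 G2] := Gint; apply: eq_ReIm => /=.
  rewrite -lim0; apply: (cvg_unique _ _ profile_cvg) => //.
  move: (damp_cvg _ G1); rewrite [X in X @ _ --> _](_ : _ =
    (fun n => \int[mu]_r profile (e n) r)%R) //; apply/funext => n.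
  have E := congr1 (@complex.Re R) (dampE n).
  rewrite -kernel_profile //; apply: etrans E; rewrite Re_cintegral.
  by apply: eq_Rintegral => y _; rewrite cReZ.
(* Every damped integral is real, so the imaginary part is a limit of zeros. *)
have cvg0 : (fun=> 0 : R) @ \oo --> (0 : R) by exact: cvg_cst.
apply: (cvg_unique _ _ cvg0) => //.
move: (damp_cvg _ G2); rewrite [X in X @ _ --> _](_ : _ = (fun=> 0)) //.
apply/funext => n; have E := congr1 (@complex.Im R) (dampE n).
apply: etrans E; rewrite Im_cintegral.
by apply: eq_Rintegral => y _; rewrite cImZ.
Qed.

End inversion.
End cahen_mellin.

(** * The Mellin-Barnes integral of the three remaining Gamma factors *)

Section mellin_chain.
Context {R : realType}.
Let mu := @lebesgue_measure R.
Let pos : set R := `]0, +oo[%classic.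

Let pos_gt0 (u : R) : pos u -> 0 < u.
Proof. by rewrite /pos /= in_itv/= andbT. Qed.

Let mpos : measurable pos.
Proof. exact: measurable_itv. Qed.

Let mT : measurable [set: R].
Proof. exact: measurableT. Qed.

(** The scale met later is k = 1 + v with v > 0, for which e^(-k u) <= e^(-u) gives the majorant. *)
Lemma integrable_rgamma_scale (a k : R) : 0 < a -> 1 <= k ->
  mu.-integrable pos (EFin \o (fun u => u `^ (a - 1) * expR (- (k * u)))).
Proof.
move=> a0 k1; apply: (lebesgue_integrable_dominated mpos _ _ (integrable_rgamma a0)).
  apply: measurable_funM; first by apply: measurable_funTS; exact: measurable_powR.
  have mk : measurable_fun setT (fun u : R => - (k * u)).
    by apply: measurableT_comp => //; apply: measurable_funM => //; exact: measurable_cst.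
  by apply: measurable_funTS; exact: (measurableT_comp (@measurable_expR R) mk).
move=> u /pos_gt0 u0; rewrite ger0_norm ?mulr_ge0 ?powR_ge0 ?expR_ge0 //.
by rewrite ler_wpM2l ?powR_ge0 // ler_expR lerN2 ler_peMl // ltW.
Qed.

Lemma rgamma_scale (a k : R) : 0 < a -> 1 <= k ->
  (\int[mu]_(u in pos) (u `^ (a - 1) * expR (- (k * u))))%R = k `^ (- a) * rgamma a.
Proof.
move=> a0 k1; have k0 : 0 < k by exact: lt_le_trans k1.
pose G (y : R) := y `^ (a - 1) * expR (- y).
have posE : pos = \bigcup_n `[k * (n.+2%:R)^-1, k * n.+2%:R]%classic.
  apply/seteqP; split => [u /pos_gt0 u0|u [n _]]; last first.
    rewrite /pos /= !in_itv/= andbT => /andP[+ _]; apply: lt_le_trans.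
    by rewrite mulr_gt0 ?invr_gt0.
  have : pos (u / k) by rewrite /pos /= in_itv/= andbT divr_gt0.
  rewrite /pos pos_exhaustion => -[n _ /=]; rewrite in_itv/= => /andP[h1 h2].
  exists n => //=; have <- : k * (u / k) = u by rewrite mulrCA divff ?mulr1 // gt_eqF.
  by rewrite in_itv/= !ler_pM2l // h1 h2.
have cG u : pos u -> {for u, continuous G}.
  move=> /pos_gt0 u0; apply: cvgM.
    by have /is_derive_continuous := is_derive1_powR (a - 1) u0.
  by apply: (@continuous_comp _ _ _ -%R expR); [exact: opp_continuous|exact: continuous_expR].
have E : rgamma a = (\int[mu]_(u in pos) (k `^ a * (u `^ (a - 1) * expR (- (k * u)))))%R.
  rewrite /rgamma /Rintegral; congr fine.
  have sub := @improper_substitution R _ _ pos pos (fun u => k * u) (cst k) G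
    pos_lt pos_ninc pos_ndec pos_exhaustion posE (fun u _ => is_derive_mulr_cst k u)
    (fun u _ => @cvg_cst _ _ _ _ _) (fun _ _ => ltW k0).
  rewrite -/pos -/(G _) sub //.
  - apply: eq_integral => u; rewrite inE => /pos_gt0 u0; congr (_%:E).
    rewrite /G /cst powRM ?ltW // -(mulr_powRB1 (ltW k0) a0); ring.
  - by move=> u v _ _ uv; rewrite ltr_pM2l.
  - by move=> u _; rewrite mulr_ge0 ?powR_ge0 ?expR_ge0.
have ka0 : 0 < k `^ a by exact: powR_gt0.
rewrite E RintegralZl //; last exact: integrable_rgamma_scale.
by rewrite mulrA powRN mulVf ?mul1r // gt_eqF.
Qed.

(** One Gamma factor is opened into its Euler integral while [K] supplies the decay in y. It is
    applied with k = -c to Gamma(ell - ct) and with k = 1 to Gamma(1/2 + t). *)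
Lemma mellin_fubini (K : R -> R[i]) (C r k : R) : 0 < r ->
  cmeasurable setT K -> (forall y, normc (K y) <= C / (1 + y ^+ 2)) ->
  cintegral setT (fun y => K y * euler_gamma (r +i* (k * y))) =
  cintegral pos (fun u => cintegral setT (fun y =>
    K y * (cpow u ((r +i* (k * y)) - 1) * (expR (- u))%:C))) /\
  cintegrable setT (fun y => K y * euler_gamma (r +i* (k * y))).
Proof.
move=> r0 mK KC.
pose F y u := K y * (cpow u ((r +i* (k * y)) - 1) * (expR (- u))%:C).
have FE y : cintegral pos (F y) = K y * euler_gamma (r +i* (k * y)).
  by rewrite /F cintegralZ //; exact: cintegrable_gamma.
have mF : cmeasurable (setT `*` pos) (fun z : R * R => F z.1 z.2).
  apply: cmeasurableM; last apply: cmeasurableM.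
  - have [m1 m2] := mK; split; apply: measurable_funTS.
      exact: (measurableT_comp m1 measurable_fst).
    exact: (measurableT_comp m2 measurable_fst).
  - apply: (@cmeasurable_cpow _ _ _ _ (r - 1)).
    + by apply: measurable_funTS; exact: measurable_snd.
    + by [].
    + apply: measurable_funTS => /=; apply: measurable_funB; last exact: measurable_cst.
      by apply: measurable_funM; [exact: measurable_cst|exact: measurable_fst].
  - apply: cmeasurable_real; apply: measurable_funTS.
    apply: measurableT_comp; first exact: measurable_expR.
    by apply: measurableT_comp => //; exact: measurable_snd.
have Fpq y u : [set: R] y -> pos u -> normc (F y u) <=
    (C / (1 + y ^+ 2)) * (u `^ (r - 1) * expR (- u)).
  move=> _ _; rewrite /F ComplexField.Normc.normcM normc_gamma_integrand.
  by apply: ler_wpM2r; [rewrite mulr_ge0 ?powR_ge0 ?expR_ge0|exact: KC].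
have [E1 E2] := cfubini mT mpos (lebesgue_integrableZ C mT integrable_cauchy)
  (integrable_rgamma r0) mF Fpq.
split; last by apply: eq_cintegrable E2 => // y _; exact: FE.
by rewrite -E1; apply: eq_cintegral => y _; rewrite FE.
Qed.

Section chain.
Variables (ell tau beta z : R).
Hypotheses (tau0 : 0 < tau) (beta0 : 0 < beta) (z0 : 0 < z)
  (tau_lt : tau < beta * ell).

Let c := beta^-1.
Let c0 : 0 < c. Proof. by rewrite invr_gt0. Qed.
Let bc : beta * c = 1. Proof. by rewrite divff // gt_eqF. Qed.
Let ct0 : 0 < c * tau. Proof. exact: mulr_gt0. Qed.
Let ellct : 0 < ell - c * tau.
Proof. by rewrite subr_gt0 /c mulrC ltr_pdivrMr // mulrC. Qed.
Let ell0 : 0 < ell.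
Proof. by rewrite -(pmulr_rgt0 _ beta0); exact: lt_trans tau_lt. Qed.

Let w (y : R) : R[i] := (c * tau) +i* (c * y).

Let Gw_decay : exists C, forall y, normc (euler_gamma (w y)) <= C / (1 + y ^+ 2).
Proof. exact: gamma_line_decay. Qed.

Let cpow_NwE (v y : R) : cpow v (- w y) = cpow v ((- (c * tau)) +i* (- c * y)).
Proof. by congr cpow; rewrite /w; apply: eq_ReIm => //=; rewrite mulNr. Qed.

Lemma stieltjes_mellin (v : R) : 0 < v ->
  cintegrable setT (fun y => euler_gamma (w y) * cpow v (- w y) *
    euler_gamma ((ell - c * tau) +i* (- c * y))) /\
  cintegral setT (fun y => euler_gamma (w y) * cpow v (- w y) *
    euler_gamma ((ell - c * tau) +i* (- c * y))) =
  (2 * pi / c * (rgamma ell * (1 + v) `^ (- ell)))%:C.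
Proof.
move=> v0; have [C hC] := Gw_decay.
pose K y := euler_gamma (w y) * cpow v (- w y).
have mK : cmeasurable setT K.
  apply: cmeasurableM; first exact: cmeasurable_gamma_line.
  by under eq_fun do rewrite cpow_NwE; exact: cmeasurable_cpow_line.
have KC y : normc (K y) <= (C * v `^ (- (c * tau))) / (1 + y ^+ 2).
  rewrite /K ComplexField.Normc.normcM normc_cpow cReN /= mulrAC.
  by apply: ler_wpM2r; [exact: powR_ge0|exact: hC].
have [E1 E2] := mellin_fubini (- c) ellct mK KC.
split=> //; rewrite {}E1.
have innerE u : pos u -> cintegral setT (fun y =>
    K y * (cpow u (((ell - c * tau) +i* (- c * y)) - 1) * (expR (- u))%:C)) =
    (2 * pi / c * (u `^ (ell - 1) * expR (- ((1 + v) * u))))%:C.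
  move=> /pos_gt0 u0; have uv0 : 0 < u * v by exact: mulr_gt0.
  (* Splitting u^(ell - ct - 1) into u^(ell - 1) and u^(-ct) lets the second power join v^(-ct), so
     that Cahen-Mellin applies at x = u v. *)
  transitivity (cintegral setT (fun y => (u `^ (ell - 1) * expR (- u))%:C *
      (euler_gamma (w y) * cpow (u * v) (- w y)))).
    apply: eq_cintegral => y _.
    have -> : ((ell - c * tau) +i* (- c * y)) - 1 = (ell - 1)%:C + (- w y).
      by apply: eq_ReIm; rewrite !(cReD, cImD, cReN, cImN) /=; ring.
    by rewrite cpowD // cpow_realE cpow_mul // rmorphM /K; ring.
  rewrite cintegralZ //; last exact: cintegrable_cahen_mellin.
  rewrite cahen_mellin // -rmorphM; congr (_%:C).
  have -> : - ((1 + v) * u) = - u + - (u * v) by ring.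
  by rewrite expRD; ring.
rewrite (eq_cintegral innerE) cintegral_real; congr (_%:C).
have v1 : 1 <= 1 + v by rewrite lerDl ltW.
rewrite RintegralZl //; last exact: integrable_rgamma_scale.
by rewrite rgamma_scale //; congr (_ * _); exact: mulrC.
Qed.

Lemma integrable_stieltjes :
  mu.-integrable pos (EFin \o (fun s => s `^ (2^-1 - 1) * expR (- s) *
    (1 + (s * z) `^ (- beta)) `^ (- ell))).
Proof.
have h0 : 0 < 2^-1 :> R by rewrite invr_gt0.
apply: (lebesgue_integrable_dominated mpos _ _ (integrable_rgamma h0)).
  apply: measurable_funM.
    have := lebesgue_integrable_measurable (integrable_rgamma h0); exact.
  have m1 : measurable_fun setT (fun s : R => (s * z) `^ (- beta)).
    apply: (measurableT_comp (measurable_powR (- beta))).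
    by apply: measurable_funM => //; exact: measurable_cst.
  apply: measurable_funTS; apply: (measurableT_comp (measurable_powR (- ell))).
  by apply: measurable_funD => //; exact: measurable_cst.
move=> s /pos_gt0 s0; rewrite ger0_norm; last first.
  by rewrite !mulr_ge0 ?powR_ge0 ?expR_ge0.
rewrite ler_piMr ?mulr_ge0 ?powR_ge0 ?expR_ge0 //.
have v1 : 1 <= 1 + (s * z) `^ (- beta) by rewrite lerDl powR_ge0.
have := @ler_powR R _ v1 (- ell) 0; rewrite powRr0; apply.
by rewrite oppr_le0 ltW.
Qed.

(** The reduced Mellin-Barnes integrand without its constant factor c. Writing [1 * y] keeps the
    factors in the shape expected by the lemmas on vertical lines. *)
Let J (y : R) : R[i] := euler_gamma (w y) *
  euler_gamma ((ell - c * tau) +i* (- c * y)) * cpow z (tau +i* (1 * y)) *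
  euler_gamma ((2^-1 + tau) +i* (1 * y)).

Lemma mellin_barnes_chain :
  cintegrable setT J /\
  cintegral setT J = (2 * pi / c * (rgamma ell *
    (\int[mu]_(s in pos) (s `^ (2^-1 - 1) * expR (- s) *
      (1 + (s * z) `^ (- beta)) `^ (- ell)))%R))%:C.
Proof.
have [C hC] := Gw_decay.
pose K y := euler_gamma (w y) * euler_gamma ((ell - c * tau) +i* (- c * y)) *
  cpow z (tau +i* (1 * y)).
have mK : cmeasurable setT K.
  apply: cmeasurableM; last exact: cmeasurable_cpow_line.
  by apply: cmeasurableM; exact: cmeasurable_gamma_line.
(* All the decay comes from Gamma(ct): Gamma(ell - ct) is bounded on the line and z^t has constant
   modulus z^tau. *)
have KC y : normc (K y) <=
    (C * (2 * rgamma (ell - c * tau) * z `^ tau)) / (1 + y ^+ 2).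
  rewrite /K 2!ComplexField.Normc.normcM normc_cpow [C * _ / _]mulrAC !mulrA.
  apply: ler_wpM2r; first exact: powR_ge0.
  rewrite -[C / _ * 2 * _]mulrA.
  apply: ler_pM; [exact: normc_ge0|exact: normc_ge0|exact: hC|].
  exact: (@normc_euler_gamma_le _ (_ +i* _) ellct).
have ht0 : 0 < 2^-1 + tau by rewrite addr_gt0 ?invr_gt0.
have [E1 E2] := mellin_fubini 1 ht0 mK KC.
split=> //; rewrite {}E1.
have innerE s : pos s -> cintegral setT (fun y =>
    K y * (cpow s (((2^-1 + tau) +i* (1 * y)) - 1) * (expR (- s))%:C)) =
    (2 * pi / c * rgamma ell * (s `^ (2^-1 - 1) * expR (- s) *
      (1 + (s * z) `^ (- beta)) `^ (- ell)))%:C.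
  move=> /pos_gt0 s0; have sz0 : 0 < s * z by exact: mulr_gt0.
  have v0 : 0 < (s * z) `^ (- beta) by exact: powR_gt0.
  transitivity (cintegral setT (fun y => (s `^ (2^-1 - 1) * expR (- s))%:C *
      (euler_gamma (w y) * cpow ((s * z) `^ (- beta)) (- w y) *
      euler_gamma ((ell - c * tau) +i* (- c * y))))).
    apply: eq_cintegral => y _.
    have -> : ((2^-1 + tau) +i* (1 * y)) - 1 =
        (2^-1 - 1)%:C + (tau +i* (1 * y)) :> R[i].
      by apply: eq_ReIm; rewrite !(cReD, cImD, cReN, cImN) /=; ring.
    (* Since beta c = 1, the choice v = (s z)^(-beta) turns v^(-ct) into (s z)^t. *)
    have -> : cpow ((s * z) `^ (- beta)) (- w y) =
        cpow s (tau +i* (1 * y)) * cpow z (tau +i* (1 * y)).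
      rewrite cpow_powR // -cpow_mul //; congr cpow.
      apply: eq_ReIm; rewrite !(cReM, cImM, cReN, cImN) /= mul0r ?subr0 ?addr0.
        by rewrite mulrNN mulrA bc mul1r.
      by rewrite mulrNN mulrA bc mul1r.
    by rewrite cpowD // cpow_realE rmorphM /K; ring.
  have [S1 S2] := stieltjes_mellin v0.
  by rewrite cintegralZ // S2 -rmorphM; congr (_%:C); ring.
rewrite (eq_cintegral innerE) cintegral_real; congr (_%:C).
rewrite RintegralZl // ?mulrA //.
exact: integrable_stieltjes.
Qed.

End chain.
End mellin_chain.

(** * The contours, the kernel and the value of the H-function *)

Section foxH.
Variables (R : realType) (L : nat) (beta z : R).
Hypotheses (hL : (1 <= L)%N) (hbeta : 0 < beta) (hz : 0 < z).
Let mu := @lebesgue_measure R.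
Let pos : set R := `]0, +oo[%classic.
Let a : seq (R[i] * R) := [:: (0, beta^-1); (1, 1); ((2^-1)%:C, 1); (1, 1)].
Let b : seq (R[i] * R) := [:: (L%:R, beta^-1); (1, 1); (0, 1)].

Let L0 : 0 < L%:R :> R. Proof. by rewrite ltr0n. Qed.

Lemma cgamma_Re_gt0 (s : R[i]) : 0 < complex.Re s -> cgamma s = euler_gamma s.
Proof. by move=> s0; rewrite /cgamma /gamma_shift s0 big_ord0 divr1 addr0. Qed.

(** The strip is cut out by the first poles of three factors: 0 for Gamma(t), 1 for Gamma(1 - t) and
    beta L for Gamma(L - t / beta). *)
Lemma foxH_separates_strip (tau : R) : foxH_separates 2 3 a b tau ->
  [/\ 0 < tau, tau < 1 & tau < beta * L%:R].
Proof.
move=> [hb ha]; split.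
- apply: (ha (1, 1) _ 0%N 0); first by rewrite !inE eqxx orbT.
  by rewrite /= subrr mulr0 addr0 oppr0.
- apply: (hb (1, 1) _ 0%N 1); first by rewrite !inE eqxx orbT.
  by rewrite /= mulr1 subrr oppr0.
- apply: (hb (L%:R, beta^-1) _ 0%N (beta * L%:R)%:C); first by rewrite !inE eqxx.
  apply: eq_ReIm; rewrite /= !(cReD, cImD, cReN, cImN) ?cReZ ?cImZ ?Re_nat ?Im_nat /=.
    by rewrite mulrA mulVf ?gt_eqF// mul1r subrr oppr0.
  by rewrite mulr0 subrr oppr0.
Qed.

Lemma strip_foxH_separates (tau : R) : 0 < tau -> tau < 1 -> tau < beta * L%:R ->
  foxH_separates 2 3 a b tau.
Proof.
move=> t0 t1 tL; split=> u; rewrite !inE.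
  case/orP => /eqP -> k t /(congr1 (@complex.Re R)).
    rewrite /= cReD !cReN Re_nat cReZ Re_nat => E.
    apply: (lt_le_trans tL); rewrite mulrC -ler_pdivlMr // mulrC.
    by have := ler0n R k; lra.
  rewrite /= cReD !cReN cReZ Re_nat mul1r /= => E.
  by have := ler0n R k; lra.
case/or3P => /eqP -> k t /(congr1 (@complex.Re R)).
- rewrite /= !(cReD, cReN) cReZ Re_nat /= => E.
  rewrite (@le_lt_trans _ _ 0) // -(@pmulr_rle0 _ beta^-1) ?invr_gt0 //.
  by have := ler0n R k; lra.
- rewrite /= !(cReD, cReN) cReZ Re_nat /= => E.
  by have := ler0n R k; lra.
- rewrite /= !(cReD, cReN) cReZ Re_nat /= => E.
  by have := ler0n R k; lra.
Qed.

(** Inside the strip every Gamma argument has positive real part, so [cgamma] is Euler's integral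
    throughout. Dividing by Gamma(1 - t) and by Gamma(1 + t) = t Gamma(t) is legitimate by
    [euler_gamma_neq0]. *)
Lemma foxH_integrandE (tau y : R) : 0 < tau -> tau < 1 -> tau < beta * L%:R ->
  foxH_integrand 2 3 a b z tau y = (beta^-1)%:C *
    (euler_gamma ((beta^-1 * tau) +i* (beta^-1 * y)) *
     euler_gamma ((L%:R - beta^-1 * tau) +i* (- beta^-1 * y)) *
     cpow z (tau +i* (1 * y)) * euler_gamma ((2^-1 + tau) +i* (1 * y))).
Proof.
move=> t0 t1 tL; set c := beta^-1; have c0 : 0 < c by rewrite invr_gt0.
pose t : R[i] := tau +i* y.
have Rt : complex.Re t = tau by [].
have ct0 : 0 < complex.Re (c%:C * t) by rewrite cReZ Rt mulr_gt0.
have Lct0 : 0 < complex.Re (L%:R - c%:C * t).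
  rewrite cReD cReN cReZ Re_nat Rt subr_gt0 /c.
  by rewrite mulrC ltr_pdivrMr // mulrC.
have t10 : 0 < complex.Re (1 - t) by rewrite cReD cReN Rt subr_gt0.
have th0 : 0 < complex.Re ((2^-1)%:C + t) by rewrite cReD Rt addr_gt0 ?invr_gt0.
have nz (s : R[i]) : 0 < complex.Re s -> s != 0.
  by move=> s0; apply: contraTneq s0 => ->; rewrite ltxx.
have tS : euler_gamma (1 + t) = t * euler_gamma t.
  by rewrite addrC euler_gammaS.
have ctS : euler_gamma (1 + c%:C * t) = c%:C * t * euler_gamma (c%:C * t).
  by rewrite addrC euler_gammaS.
have Re1 (s : R[i]) : 0 < complex.Re s -> 0 < complex.Re (1 + s).
  by move=> s0; rewrite cReD addr_gt0 //= ltr01.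
rewrite /foxH_integrand /foxH_kernel /= !big_cons !big_nil -/t -/c; cbn [fst snd].
rewrite [1 * y]mul1r !subr0 !mul1r !mulr1 subrr add0r.
have -> : 1 - (2^-1)%:C = (2^-1)%:C :> R[i].
  by apply: eq_ReIm; rewrite !(cReD, cImD, cReN, cImN) /=; lra.
rewrite !cgamma_Re_gt0 //; try exact: Re1.
rewrite tS ctS.
have -> : ((c * tau) +i* (c * y)) = c%:C * t.
  by apply: eq_ReIm; rewrite ?cReZ ?cImZ.
have -> : ((L%:R - c * tau) +i* (- c * y)) = L%:R - c%:C * t.
  by apply: eq_ReIm; rewrite !(cReD, cImD, cReN, cImN) ?cReZ ?cImZ ?Re_nat ?Im_nat /=; ring.
have -> : ((2^-1 + tau) +i* y) = (2^-1)%:C + t.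
  by apply: eq_ReIm; rewrite !(cReD, cImD) /=; ring.
have n1 := euler_gamma_neq0 t10.
have n2 := @euler_gamma_neq0 R t t0.
have n3 := nz t t0.
by field; rewrite n1 n2 n3.
Qed.

(** The chain of integrals can be run on any line of the strip and ends in an expression without
    tau; this gives independence of the contour. *)
Lemma foxH_value : is_foxH 2 3 a b z (rgamma L%:R *
  (\int[mu]_(s in pos) (s `^ (2^-1 - 1) * expR (- s) *
    (1 + (s * z) `^ (- beta)) `^ (- L%:R)))%R)%:C.
Proof.
split.
  (* The middle of the admissible strip. *)
  exists (Num.min 1 (beta * L%:R) / 2).
  have m0 : 0 < Num.min 1 (beta * L%:R) by rewrite lt_min ltr01 mulr_gt0.
  have m1 : Num.min 1 (beta * L%:R) <= 1 by rewrite ge_min lexx.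
  have m2 : Num.min 1 (beta * L%:R) <= beta * L%:R by rewrite ge_min lexx orbT.
  by apply: strip_foxH_separates; lra.
move=> tau /foxH_separates_strip[t0 t1 tL].
have [J1 J2] := mellin_barnes_chain t0 hbeta hz tL.
have E y : setT y -> _ := fun _ => foxH_integrandE y t0 t1 tL.
split.
  apply: (eq_cintegrable measurableT (fun y h => esym (E y h))).
  exact: cintegrableZ.
rewrite (eq_cintegral E) cintegralZ // J2 -!rmorphM.
congr (_%:C); rewrite !mulrA invrK; set I := Rintegral _ _ _.
have pi0 : pi != 0 :> R by rewrite gt_eqF ?pi_gt0.
have b0 : beta != 0 by rewrite gt_eqF.
by move: (pi : R) pi0 => p p0; field; rewrite p0 b0.
Qed.
End foxH.

(** * Average error rate *)

Section error_rate.
Variables (R : realType) (delta zeta : R) (f Phi : R -> R).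
Hypotheses (delta0 : 0 <= delta) (zeta0 : 0 < zeta) (f_ge0 : forall x, 0 <= f x)
  (mf : measurable_fun setT f) (cPhi : forall x, 0 < x -> {for x, continuous Phi}).
Let mu := @lebesgue_measure R.
Let pos : set R := `]0, +oo[%classic.
Hypothesis f_Phi : forall x, 0 < x -> (\int[mu]_(g in `[0%R, x]) (f g)%:E)%E = (Phi x)%:E.

Let pos_gt0 (u : R) : pos u -> 0 < u.
Proof. by rewrite /pos /= in_itv /= andbT. Qed.

Let Phi_ge0 x : 0 < x -> 0 <= Phi x.
Proof.
by move=> x0; rewrite -lee_fin -f_Phi //; apply: integral_ge0 => g _; rewrite lee_fin.
Qed.

Let kappa := delta * (2 / Num.sqrt pi).

Let kappa0 : 0 <= kappa.
Proof. by rewrite mulr_ge0 // divr_ge0 // sqrtr_ge0. Qed.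

(** The joint integrand in the SNR g and the erfc variable t. The region sqrt (zeta g) < t is
    written without a square root, so that it can be sliced in either variable. *)
Let h (p : R * R) : R := if (0 <= p.1) && ((0 < p.2) && (zeta * p.1 < p.2 ^+ 2))
  then kappa * expR (- p.2 ^+ 2) * f p.1 else 0.

Let h_ge0 p : 0 <= h p.
Proof. by rewrite /h; case: ifP => // _; rewrite !mulr_ge0 // expR_ge0. Qed.

Let mh : measurable_fun setT h.
Proof.
have m1 : measurable_fun setT (fun p : R * R => p.1) by exact: measurable_fst.
have m2 : measurable_fun setT (fun p : R * R => p.2) by exact: measurable_snd.
have m22 : measurable_fun setT (fun p : R * R => p.2 ^+ 2).
  by apply: measurable_funX.
apply: measurable_fun_ifT => //.
  apply: measurable_and; first exact: measurable_fun_ler.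
  apply: measurable_and; first exact: measurable_fun_ltr.
  by apply: measurable_fun_ltr => //; apply: measurable_funM.
apply: measurable_funM; last exact: measurableT_comp.
apply: measurable_funM => //; apply: measurableT_comp => //.
exact: measurableT_comp.
Qed.

Lemma integrable_gauss (D : set R) : measurable D ->
  mu.-integrable D (EFin \o (fun t => expR (- t ^+ 2))).
Proof.
by move=> mD; apply: integrableS (@integrableT_gauss R).
Qed.

Let h_fst g : (\int[mu]_t (h (g, t))%:E)%E =
  ((fun x => (delta * erfc (Num.sqrt (zeta * x)) * f x)%:E) \_ `[0%R, +oo[) g.
Proof.
rewrite patchE mem_setE in_itv /= andbT; case: ifPn => g0; last first.
  by apply: integral0_eq => t _; rewrite /h /= (negbTE g0).
pose s := Num.sqrt (zeta * g).
have s0 : 0 <= s by exact: sqrtr_ge0.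
have s2 : s ^+ 2 = zeta * g by rewrite sqr_sqrtr // mulr_ge0 // ltW.
pose D : set R := `]s, +oo[%classic.
have mD : measurable D by exact: measurable_itv.
transitivity (\int[mu]_(t in D) (kappa * f g * expR (- t ^+ 2))%:E)%E.
  rewrite [RHS]integral_mkcond; apply: eq_integral => t _.
  rewrite patchE mem_setE in_itv /= andbT /h /= g0 /= -s2.
  have -> : (0 < t) && (s ^+ 2 < t ^+ 2) = (s < t).
    by apply/andP/idP => [[t0 st]|st]; [nra|split; nra].
  by case: ifP => // _; congr EFin; ring.
rewrite -EFin_Rintegral //; last first.
  exact: lebesgue_integrableZ (integrable_gauss mD).
rewrite RintegralZl //; last exact: integrable_gauss.
rewrite Rintegral_itv_obnd_cbnd; last exact: integrable_gauss.
by congr EFin; rewrite /erfc -/s /kappa; ring.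
Qed.

Let h_snd t : (\int[mu]_g (h (g, t))%:E)%E =
  ((fun t => (kappa * expR (- t ^+ 2) * Phi (t ^+ 2 / zeta))%:E) \_ pos) t.
Proof.
rewrite patchE mem_setE in_itv /= andbT; case: ifPn => t0; last first.
  by apply: integral0_eq => g _; rewrite /h /= (negbTE t0) andbF.
have x0 : 0 < t ^+ 2 / zeta by rewrite divr_gt0 // exprn_gt0.
transitivity (\int[mu]_(g in `[0%R, (t ^+ 2 / zeta)%R[)
    ((kappa * expR (- t ^+ 2))%:E * (f g)%:E))%E.
  rewrite [RHS]integral_mkcond; apply: eq_integral => g _.
  rewrite patchE mem_setE in_itv /= /h /= t0 /= ltr_pdivlMr // [g * _]mulrC.
  by case: ifP.
have mfD (D : set R) : measurable D -> measurable_fun D (fun g => (f g)%:E).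
  by move=> mD; apply/measurable_EFinP; exact: measurable_funTS.
rewrite ge0_integralZl //.
- rewrite (_ : (\int[mu]_(g in _) _)%E = (Phi (t ^+ 2 / zeta))%:E) -?EFinM //.
  (* The slice is half-open because of the strict inequality in [h], whereas [f_Phi] concerns a
     closed interval; the end point is a null set. *)
  by rewrite -f_Phi //; apply: integral_itv_bndo_bndc; apply: mfD.
- exact: mfD.
- by move=> g _; rewrite lee_fin.
- by rewrite lee_fin mulr_ge0 // expR_ge0.
Qed.

Let G (s : R) := delta / Num.sqrt pi * (s `^ (2^-1 - 1) * expR (- s) * Phi (s / zeta)).

Let G_subst : (\int[mu]_(s in pos) (G s)%:E)%E =
  (\int[mu]_(t in pos) (kappa * expR (- t ^+ 2) * Phi (t ^+ 2 / zeta))%:E)%E.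
Proof.
have E : pos = \bigcup_n `[(n.+2%:R : R)^-1 ^+ 2, n.+2%:R ^+ 2]%classic.
  apply/seteqP; split => [w w0|w [n _] /=].
    have s0 : pos (Num.sqrt w).
      by rewrite /pos /= in_itv /= andbT sqrtr_gt0 pos_gt0.
    move: (s0); rewrite {1}/pos pos_exhaustion => -[n _ /= sn]; exists n => //=.
    move: sn; rewrite !in_itv /= => /andP[s1 s2].
    rewrite -(sqr_sqrtr (ltW (pos_gt0 w0))).
    by rewrite !lerXn2r // nnegrE ?sqrtr_ge0 // invr_ge0 ler0n.
  rewrite /pos /= !in_itv /= andbT => /andP[+ _]; apply: lt_le_trans.
  by rewrite exprn_gt0 // invr_gt0 ltr0n.
transitivity (\int[mu]_(t in pos) (G (t ^+ 2) * (2 * t))%:E)%E; last first.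
  apply: eq_integral => t; rewrite inE => /pos_gt0 t0; congr EFin.
rewrite /G /kappa -powR_mulrn ?(ltW t0) // -powRrM.
  (* With s = t^2 the factor s^(-1/2) becomes 1 / t and cancels the t of the Jacobian 2 t. *)
  have -> : 2%:R * (2^-1 - 1) = -1 :> R by field.
  rewrite powR_inv1 ?(ltW t0) // powR_mulrn ?(ltW t0) //.
  have sp : Num.sqrt pi != 0 :> R by rewrite gt_eqF // sqrtr_gt0 pi_gt0.
  have tn : t != 0 by rewrite gt_eqF.
  by move: (Num.sqrt pi : R) sp => q q0; field; rewrite q0 tn.
apply: (@improper_substitution R _ _ pos pos (fun t => t ^+ 2) (fun t => 2 * t) G (@pos_lt R)
   (@pos_ninc R) (@pos_ndec R) (@pos_exhaustion R) E).
- move=> t _; apply: is_derive_eq (is_derive_mul (is_derive_id t 1) (is_derive_id t 1)) _.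
  by ring.
- move=> t _; apply: continuousM; [exact: cvg_cst|exact: cvg_id].
- by move=> t /pos_gt0 t0; rewrite mulr_ge0 // ltW.
- by move=> x y /pos_gt0 x0 /pos_gt0 y0 xy; nra.
- move=> s /pos_gt0 s0; rewrite /G.
  apply: continuousM; first exact: cvg_cst.
  apply: continuousM; last first.
    apply: (@continuous_comp _ _ _ (fun s : R => s / zeta) Phi).
      by apply: continuousM; [exact: cvg_id|exact: cvg_cst].
    by apply: cPhi; rewrite divr_gt0.
  apply: continuousM.
    exact: is_derive_continuous (is_derive1_powR _ s0).
  exact: is_derive_continuous (is_derive_compose (is_derive_expR _)
    (is_derive_opp (is_derive_id s 1))).
- move=> s /pos_gt0 s0; rewrite /G !mulr_ge0 ?powR_ge0 ?expR_ge0 ?invr_ge0 ?sqrtr_ge0 //.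
  by apply: Phi_ge0; rewrite divr_gt0.
Qed.

(** Tonelli for the nonnegative [h] equates the two iterated integrals as extended numbers, and
    taking [fine] gives the real identity. *)
Lemma average_berE : average_ber delta zeta f =
  (\int[mu]_(s in pos) (delta / Num.sqrt pi *
     (s `^ (2^-1 - 1) * expR (- s) * Phi (s / zeta))))%R.
Proof.
have mhE : measurable_fun setT (EFin \o h) by exact/measurable_EFinP.
have := @fubini_tonelli _ _ _ _ R mu mu (EFin \o h) mhE (fun p => h_ge0 p).
have -> : (\int[mu]_g \int[mu]_t (EFin \o h) (g, t))%E =
    (\int[mu]_(x in `[0%R, +oo[) (delta * erfc (Num.sqrt (zeta * x)) * f x)%:E)%E.
  by rewrite [RHS]integral_mkcond; apply: eq_integral => g _; exact: h_fst.
have -> : (\int[mu]_t \int[mu]_g (EFin \o h) (g, t))%E = (\int[mu]_(s in pos) (G s)%:E)%E.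
  by rewrite G_subst [RHS]integral_mkcond; apply: eq_integral => t _; exact: h_snd.
move=> e.
by rewrite /average_ber /Rintegral e.
Qed.
End error_rate.

(** * Distribution of the maximum and conclusion *)

Lemma selection_combining_cdf (R : realType) (d : measure_display) (T : measurableType d)
    (P : probability T R) (L : nat) (X : 'I_L -> {RV P >-> R}) (x F : R) :
  mutually_independent X -> 0 <= x -> (forall l, cdf (X l) x = F%:E) ->
  P (selection_combining X @^-1` `[0, x]) = (F ^+ L)%:E.
Proof.
move=> X_indep x0 XF.
(* The initial value 0 of the maximum makes the lower bound automatic, and 0 <= x keeps that value
   below x; what remains is that every branch is at most x. *)
have -> : selection_combining X @^-1` `[0, x] =
    \bigcap_(l in [set` [set: 'I_L]%SET]) (X l @^-1` `]-oo, x]).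
  apply/seteqP; split => w /=; rewrite /selection_combining in_itv /=.
    by case/andP => _ /bigmax_leP[_ wx] l _ /=; rewrite in_itv /= wx.
  move=> wx; apply/andP; split; first exact: bigmax_ge_id.
  apply/bigmax_leP; split => // l _.
  by have := wx l; rewrite /= in_itv /=; apply; rewrite /= inE.
rewrite X_indep; last by move=> l; exact: measurable_itv.
rewrite (eq_bigr (fun=> F%:E)) => [|l _]; last exact: XF.
by rewrite prodEFin prodr_const cardsT card_ord.
Qed.

Theorem corollary1 (R : realType) (d : measure_display) (T : measurableType d)
    (P : probability T R) (L : nat) (rho alpha beta delta zeta : R)
    (hL : (1 <= L)%N) (hrho : 0 < rho) (halpha : 0 < alpha) (hbeta : 0 < beta)
    (hdelta : 0 < delta) (hzeta : 0 < zeta)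
    (X : 'I_L -> {RV P >-> R})
    (X_indep : mutually_independent X)
    (X_ident : identically_distributed X)
    (X_ge0 : forall (l : 'I_L) (w : T), 0 <= X l w)
    (X_cdf : forall (l : 'I_L) (g : R), 0 < g ->
       cdf (X l) g = ((1 + (g / (rho * alpha)) `^ (- beta))^-1)%:E)
    (f_SC : R -> R)
    (f_SC_pdf : is_pdf P (selection_combining X) f_SC) :
  exists2 H : R[i],
    is_foxH 2 3
      [:: (0, beta^-1); (1, 1); ((2^-1)%:C, 1); (1, 1)]
      [:: (L%:R, beta^-1); (1, 1); (0, 1)]
      (1 / (zeta * alpha * rho)) H
  & (average_ber delta zeta f_SC)%:C =
    delta%:C / ((Num.sqrt pi)%:C * cgamma L%:R) * H.
Proof.
case: f_SC_pdf => mf f0 fP.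
set z := 1 / (zeta * alpha * rho).
have z0 : 0 < z by rewrite divr_gt0 // !mulr_gt0.
have L0 : 0 < L%:R :> R by rewrite ltr0n.
pose F (g : R) := (1 + (g / (rho * alpha)) `^ (- beta))^-1.
have F1 (g : R) : 0 < 1 + (g / (rho * alpha)) `^ (- beta).
  by rewrite ltr_wpDr ?powR_ge0.
have cF g : 0 < g -> {for g, continuous (fun g => F g ^+ L)}.
  move=> g0; apply: (@continuous_comp _ _ _ F (fun y => y ^+ L)); last exact: exprn_continuous.
  apply: continuousV; first by rewrite gt_eqF.
  apply: continuousD; first exact: cvg_cst.
  apply: (@continuous_comp _ _ _ (fun g : R => g / (rho * alpha)) (fun x => x `^ (- beta))).
    by apply: continuousM; [exact: cvg_id|exact: cvg_cst].
  have g'0 : 0 < g / (rho * alpha) by rewrite divr_gt0 // mulr_gt0.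
  exact: is_derive_continuous (is_derive1_powR _ g'0).
have fF x : 0 < x ->
    (\int[@lebesgue_measure R]_(g in `[0%R, x]) (f_SC g)%:E)%E = (F x ^+ L)%:E.
  move=> x0; rewrite -fP; last exact: measurable_itv.
  by apply: selection_combining_cdf => // [|l]; [exact: ltW|exact: X_cdf].
have := @foxH_value R L beta z hL hbeta z0.
set M := Rintegral _ _ _ => hM.
exists (rgamma L%:R * M)%:C => //.
have -> : average_ber delta zeta f_SC = delta / Num.sqrt pi * M.
  (* The abscissa beta L / 2 is a point strictly between 0 and beta L, as the hypotheses require. *)
  have sM := @integrable_stieltjes R L%:R (beta * L%:R / 2) beta z.
  rewrite (average_berE (ltW hdelta) hzeta f0 mf cF fF) /M -RintegralZl //; last first.
    by apply: sM => //; nra.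
  apply: eq_Rintegral => s; rewrite inE /= in_itv /= andbT => s0.
  (* The power L of the distribution function is a natural one, while the H-function side carries
     the real exponent -L; both become inverse natural powers, and s / (zeta rho alpha) is s z. *)
  congr (_ * (_ * _)); rewrite powR_invn ?exprVn; last first.
    by rewrite addr_ge0 // powR_ge0.
  congr ((1 + _ `^ _) ^- _); rewrite /z; field.
  by rewrite !gt_eqF.
have -> : cgamma (L%:R : R[i]) = (rgamma L%:R)%:C.
  rewrite cgamma_Re_gt0; last by rewrite Re_nat.
  by rewrite -nat_complex euler_gamma_real.
have r0 : rgamma (L%:R : R) != 0 by rewrite gt_eqF // rgamma_gt0 // ler1n.
have s0 : Num.sqrt pi != 0 :> R by rewrite gt_eqF // sqrtr_gt0 pi_gt0.
rewrite -!rmorphM -fmorphV -!rmorphM; congr (_%:C).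
by move: (Num.sqrt pi : R) (rgamma _) s0 r0 => q r q0 r0; field; rewrite q0 r0.
Qed.
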